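(* Let $n_1,n_2,k_1,k_2$ be positive integers and $\lambda>0$. For any $0<r<1$ and any integer $D\ge1$, if $$\lambda^2\le\frac r{(D(D+1))^2}\min\left(1,\frac{k_1^2\wedge k_2^2}{n_1\vee n_2}\right),$$ then $$\inf_{\widehat M\in\mathbb R[Y]^{n_1\times n_2}_{\le D}}\mathbb E_{Y,\,M\sim\mathbb P_{\mathrm{BC}(\lambda)}}\big(\ell(\widehat M,M)\big)\ \ge\ \frac{\lambda^2}{k_1\wedge k_2}-\left(\frac{\lambda^2}{k_1^2\wedge k_2^2}+\frac{r(2-r)\lambda^2}{(1-r)^2(n_1\vee n_2)}\right).$$
   Context: The prior $\mathbb P_{\mathrm{BC}(\lambda)}$ on $n_1\times n_2$ matrices: sample $z_1\in[k_1]^{n_1}$, $z_2\in[k_2]^{n_2}$ with all coordinates $(z_1)_i$, $(z_2)_j$ mutually independent and uniform on $\{1,\dots,k_1\wedge k_2\}$, and set $M_{ij}=\lambda\mathbf 1((z_1)_i=(z_2)_j)$. One observes $Y=M+E$, where $E\in\mathbb R^{n_1\times n_2}$ has i.i.d. $N(0,1)$ entries independent of $M$. The expectation is over $M$ and $Y$. The loss is $\ell(\widehat M,M)=\frac1{n_1n_2}\sum_{i\in[n_1],j\in[n_2]}(\widehat M_{ij}-M_{ij})^2$. The notation $\widehat M\in\mathbb R[Y]^{n_1\times n_2}_{\le D}$ means every entry $\widehat M_{ij}$ is a real polynomial of degree at most $D$ in the entries of $Y$. $a\wedge b=\min(a,b)$, $a\vee b=\max(a,b)$. *)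

(* Defs.v *)
From HB Require Import structures.
From mathcomp Require Import all_boot all_order all_algebra.
From mathcomp Require Import all_classical all_reals all_analysis.
(* The notations of mpoly clash with those of MathComp-Analysis. *)
From mathcomp Require Import -(notations) mpoly.

Set Implicit Arguments.
Unset Strict Implicit.
Unset Printing Implicit Defensive.

Import Order.TTheory GRing.Theory Num.Theory.
Import numFieldNormedType.Exports.

Local Open Scope classical_set_scope.
Local Open Scope ring_scope.

Section Independence.
Context (R : realType) (d : measure_display) (Omega : measurableType d)
  (P : probability Omega R).

Definition mutually_independent (I : finType) (F : I -> set_system Omega) :
    Prop :=
  forall (J : {set I}) (A : I -> set Omega),
    (forall i, i \in J -> F i (A i)) ->
    P (\bigcap_(i in [set` J]) A i) = (\prod_(i in J) P (A i))%E.

Definition independent_systems (F G : set_system Omega) : Prop :=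
  forall A B, F A -> G B -> P (A `&` B) = (P A * P B)%E.

Definition sigma_var (X : Omega -> R) : set_system Omega :=
  preimage_set_system setT X measurable.

(* The sigma-algebra generated by the entries of a random matrix. *)
Definition sigma_mx (m n : nat) (X : Omega -> 'M[R]_(m, n)) :
    set_system Omega :=
  <<s \bigcup_(ij in [set: 'I_m * 'I_n])
        sigma_var (fun w => X w ij.1 ij.2) >>.

(* The sigma-algebra generated by a label; the label space is discrete. *)
Definition sigma_label (k : nat) (z : Omega -> 'I_k) : set_system Omega :=
  preimage_set_system setT z discrete_measurable.

End Independence.

Section Model.
Context (R : realType) (n1 n2 k1 k2 : nat).

(* The label 'a' of [k] = {1, ..., k} is encoded as the ordinal a - 1 of 'I_k;
   labels from 'I_k1 and 'I_k2 are compared as naturals. *)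
Definition bc_signal (lambda : R) (z1 : 'I_n1 -> 'I_k1) (z2 : 'I_n2 -> 'I_k2) :
    'M[R]_(n1, n2) :=
  \matrix_(i, j) (lambda * (z1 i == z2 j :> nat)%:R).

Definition loss (A B : 'M[R]_(n1, n2)) : R :=
  (n1 * n2)%:R^-1 * \sum_(i < n1) \sum_(j < n2) (A i j - B i j) ^+ 2.

(* A candidate estimator: a matrix of polynomials in n1 * n2 variables, the
   variable of index mxvec_index i j standing for the entry (i, j) of Y.
   msize is 1 + total degree (and 0 for the zero polynomial). *)
Definition poly_estimator := 'M[mpoly (n1 * n2) R]_(n1, n2).

Definition degree_le (D : nat) (Mhat : poly_estimator) : Prop :=
  forall i j, (mpoly.msize (Mhat i j) <= D.+1)%N.

Definition estimate (Mhat : poly_estimator) (Y : 'M[R]_(n1, n2)) :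
    'M[R]_(n1, n2) :=
  \matrix_(i, j) meval (fun v => mxvec Y 0 v) (Mhat i j).

Context (d : measure_display) (Omega : measurableType d)
  (P : probability Omega R).

Definition uniform_label (k : nat) (z : Omega -> 'I_k) : Prop :=
  forall a : 'I_k,
    measurable (z @^-1` [set a]) /\
    P (z @^-1` [set a]) =
      (if (a < minn k1 k2)%N then (minn k1 k2)%:R^-1 else 0)%:E.

Definition latent_signal (lambda : R)
    (z1 : 'I_n1 -> Omega -> 'I_k1) (z2 : 'I_n2 -> Omega -> 'I_k2) (w : Omega) :
    'M[R]_(n1, n2) :=
  bc_signal lambda (fun i => z1 i w) (fun j => z2 j w).

Definition noise (E : 'I_n1 -> 'I_n2 -> {RV P >-> R}) (w : Omega) :
    'M[R]_(n1, n2) :=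
  \matrix_(i, j) E i j w.

Record bc_model (lambda : R) (M Y : Omega -> 'M[R]_(n1, n2)) : Prop := BCModel {
  bc_prior : exists (z1 : 'I_n1 -> Omega -> 'I_k1)
                    (z2 : 'I_n2 -> Omega -> 'I_k2),
    [/\ forall i, uniform_label (z1 i),
        forall j, uniform_label (z2 j),
        mutually_independent P (fun v : 'I_n1 + 'I_n2 =>
          match v with
          | inl i => sigma_label (z1 i)
          | inr j => sigma_label (z2 j)
          end)
      & forall w, M w = latent_signal lambda z1 z2 w];
  bc_noise : exists E : 'I_n1 -> 'I_n2 -> {RV P >-> R},
    [/\ forall i j A, measurable A ->
          distribution P (E i j) A = normal_prob 0 1 A,
        mutually_independent P (fun ij : 'I_n1 * 'I_n2 =>
          sigma_var (E ij.1 ij.2)),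
        independent_systems P (sigma_mx M) (sigma_mx (noise E))
      & forall w, Y w = M w + noise E w]
}.

Definition low_degree_mmse (D : nat) (M Y : Omega -> 'M[R]_(n1, n2)) : \bar R :=
  ereal_inf [set ('E_P [fun w => loss (estimate Mhat (Y w)) (M w)])%E
            | Mhat in [set Mhat | degree_le D Mhat]].

End Model.

(* Main.v *)
(* The noise is handled by weak duality. Write x = M_ij, Y = M + Z, and let
   kappa_s be the joint cumulant of x and the entries M_e, e in s. The Hermite
   polynomial g(Z) = \sum_s kappa_s He_s(Z) / |s|!, summed over sequences s of
   at most D entries, satisfies E[f(Y) g(Z)] = E[f(Y) x] for every f of degree
   at most D, hence E[(f(Y) - x)^2] >= E[x^2] - E[g(Z)^2], where
   E[g(Z)^2] = \sum_s kappa_s^2 / |s|!.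

   The moments of M are lambda^|s| p(s), where p(s) is the density of the
   subgroup of labellings (with values in Z/k, k = min(k1, k2)) that satisfy the
   equality constraints of s. Comparing orders of subgroups gives
   p(a) p(b) <= p(a ++ b), with equality for transversal subgroups. Therefore
   |kappa_s| <= lambda^(|s|+1) (|s|+1)^|s| p(x :: s), and kappa_s vanishes unless the
   bipartite multigraph x :: s is connected without leaves. In the remaining
   case, if the graph has e + 1 vertices then p(x :: s) <= k^-e and e <= |s|, and a
   union bound over such graphs gives the term r (2 - r) / (1 - r)^2. *)
Require Import Defs.
From HB Require Import structures.
From mathcomp Require Import all_boot all_order all_algebra.
From mathcomp Require Import -(notations) mpoly.
From mathcomp Require Import ring lra zify.

Set Implicit Arguments.
Unset Strict Implicit.
Unset Printing Implicit Defensive.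

Import Order.TTheory GRing.Theory Num.Theory.

Local Open Scope ring_scope.

(** * Sums over unshuffles and joint cumulants *)

(** The cumulants are forced by the duality. Test [g] against Hermite polynomials in the variable
    [Y] and integrate by parts: each letter of an index [u] becomes either a factor [M_e] or a
    derivative of [g]. So [E[f(Y) g(Z)] = E[f(Y) x]] says that [kappa_a mu_b], summed over the
    splits of [u] into [a] and [b], equals [nu_u]; this is the recursion of joint cumulants with the
    block of [x] singled out. The empty sequence has [kappa = lambda / k], whence the term
    [lambda^2 / k^2]. Now let [|s| = m >= 1] and let [n] be the larger dimension. Without leaves,
    the [m + 1] edges meet at most [(m + 1) / 2] rows and as many columns, so [e <= m]. Hence
    [min(1, k^2 / n)^m <= (k^2 / n)^e], which cancels the [k^(-2e)] of the squared cumulant and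
    leaves [n^(-e)]. The cumulant bound costs [(m + 1)^(2m)] and the graph count [(m + 1)! m^(2m)];
    the [m]-th power of [(D (D + 1))^2] pays for both powers, and [(m + 1)! / m!] leaves the series
    of [(m + 1) r^m]. *)

Fixpoint usum (T : Type) (V : zmodType) (F : seq T -> seq T -> V) (s : seq T) : V :=
  if s is e :: s' then
    usum (fun a b => F (e :: a) b) s' + usum (fun a b => F a (e :: b)) s'
  else F [::] [::].

Section UsumZmod.
Variables (T : Type) (V : zmodType).
Implicit Types (F G : seq T -> seq T -> V) (s : seq T).

Lemma usum_sum (I : Type) (r : seq I) (P : pred I) (F : I -> seq T -> seq T -> V) s :
  usum (fun a b => \sum_(i <- r | P i) F i a b) s = \sum_(i <- r | P i) usum (F i) s.
Proof. by elim: s F => [|e s IH] F //=; rewrite !IH big_split. Qed.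

Lemma usum0 s : usum (fun _ _ => 0 : V) s = 0.
Proof. by elim: s => //= e s ->; rewrite addr0. Qed.

End UsumZmod.

Section UsumEq.
Variables (T : eqType) (V : zmodType).
Implicit Types (F G : seq T -> seq T -> V) (s : seq T).

Lemma eq_usum F G s :
  (forall a b, perm_eq (a ++ b) s -> F a b = G a b) -> usum F s = usum G s.
Proof.
elim: s F G => [|e s IH] F G FG /=; first exact: FG.
congr (_ + _); apply: IH => a b ab; apply: FG.
  by rewrite /= perm_cons.
by rewrite -cat1s perm_catCA /= perm_cons.
Qed.

Definition perm_invariant (U : Type) (f : seq T -> U) :=
  forall s t, perm_eq s t -> f s = f t.

Lemma perm_invariant_cons (U : Type) (f : seq T -> U) e :
  perm_invariant f -> perm_invariant (fun s => f (e :: s)).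
Proof. by move=> fP s t st; apply: fP; rewrite perm_cons. Qed.

(** Symmetry in each argument separately suffices: moving a letter to the front of the list only
    permutes letters inside [a] or inside [b]. *)
Lemma perm_usum F :
  (forall b, perm_invariant (F^~ b)) -> (forall a, perm_invariant (F a)) ->
  perm_invariant (usum F).
Proof.
move=> F1 F2 s; elim: s F F1 F2 => [|e s IH] F F1 F2 t.
  by rewrite perm_sym => /perm_nilP ->.
move=> st; have et : e \in t by rewrite -(perm_mem st) mem_head.
case/splitPr: et st => t1 t2 st.
have {}st : perm_eq s (t1 ++ t2).
  by move: st; rewrite perm_sym -cat1s perm_catCA /= perm_cons perm_sym.
have -> : usum F (t1 ++ e :: t2) = usum F (e :: t1 ++ t2).
  elim: t1 F F1 F2 {st} => //= f t1 IHt F F1 F2.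
  rewrite !IHt /=; try by [move=> b; apply: perm_invariant_cons |
    move=> b u v uv; first [apply: F1 | apply: F2]; rewrite ?perm_cons].
  rewrite addrACA; congr (_ + _ + (_ + _)); apply: eq_usum => a b _.
    by apply: F1; rewrite (perm_catCA [:: f] [:: e]).
  by apply: F2; rewrite (perm_catCA [:: f] [:: e]).
by rewrite /=; congr (_ + _); apply: IH => //; try (by
  move=> b; apply: perm_invariant_cons); move=> b u v uv;
  first [apply: F1 | apply: F2]; rewrite ?perm_cons.
Qed.

End UsumEq.

Section UsumNum.
Variables (T : eqType) (R : realFieldType).
Implicit Types (F G : seq T -> seq T -> R) (s : seq T).

Lemma usumZ c F s : usum (fun a b => c * F a b) s = c * usum F s.
Proof. by elim: s F => [|e s IH] F //=; rewrite !IH mulrDr. Qed.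

Lemma ler_norm_usum F G s :
  (forall a b, perm_eq (a ++ b) s -> `|F a b| <= G a b) ->
  `|usum F s| <= usum G s.
Proof.
elim: s F G => [|e s IH] F G FG /=; first exact: FG.
apply: le_trans (ler_normD _ _) _; apply: lerD; apply: IH => a b ab; apply: FG.
  by rewrite /= perm_cons.
by rewrite -cat1s perm_catCA /= perm_cons.
Qed.

Lemma usum_exp (c : R) s : usum (fun a b => c ^+ size a) s = (c + 1) ^+ size s.
Proof.
elim: s => [|e s IH] //=; rewrite ?expr0 //.
have -> : usum (fun a b : seq T => c ^+ (size a).+1) s = c * usum (fun a b => c ^+ size a) s.
  by rewrite -usumZ; apply: eq_usum => a b _; rewrite exprS.
by rewrite IH exprS mulrDl mul1r.
Qed.

End UsumNum.

Section Cumulant.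
Variables (T : eqType) (R : realFieldType).
Implicit Types (mu nu : seq T -> R) (s : seq T).

(** [n] is fuel: the recursion passes to the sublists [a] left after removing a nonempty [b], which
    are not structural subterms of [s]. Any fuel at least [size s] gives the same value. *)
Fixpoint cumulant_rec mu nu (n : nat) s : R :=
  if n is n'.+1 then
    nu s - usum (fun a b => if nilp b then 0 else cumulant_rec mu nu n' a * mu b) s
  else nu s.

(* If [mu s = E[X_s]] and [nu s = E[x X_s]], where [X_s] is the product of the
   [X_e] for [e] in [s], then this is the joint cumulant of [x] and the [X_e]. *)
Definition cumulant mu nu s := cumulant_rec mu nu (size s) s.

Lemma usum_nilp (F : seq T -> seq T -> R) s :
  usum F s = F s [::] + usum (fun a b => if nilp b then 0 else F a b) s.
Proof.
elim: s F => [|e s IH] F /=; first by rewrite addr0.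
by rewrite IH -addrA.
Qed.

Lemma size_usum_lt s a b : perm_eq (a ++ b) s -> ~~ nilp b -> (size a < size s)%N.
Proof. by move=> /perm_size <-; rewrite size_cat /nilp; case: b => //= *; lia. Qed.

Lemma cumulant_recS mu nu n s : cumulant_rec mu nu n.+1 s =
  nu s - usum (fun a b => if nilp b then 0 else cumulant_rec mu nu n a * mu b) s.
Proof. by []. Qed.

Lemma cumulant_rec_size mu nu n s :
  (size s <= n)%N -> cumulant_rec mu nu n s = cumulant mu nu s.
Proof.
rewrite /cumulant; have [m] := ubnP (size s).
elim: m n s => // m IH [|n] s; first by move=> _; case: s.
case: s => [|e s]; first by move=> _ _ /=; rewrite subr0.
move=> tm tn; rewrite [size (e :: s)]/= !cumulant_recS.
congr (_ - _); apply: eq_usum => a b ab.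
have [//|bN] := ifPn; have /= lt_as := size_usum_lt ab bN; rewrite /= in tm tn.
by rewrite !IH //; lia.
Qed.

Lemma cumulantE mu nu s :
  cumulant mu nu s =
  nu s - usum (fun a b => if nilp b then 0 else cumulant mu nu a * mu b) s.
Proof.
rewrite {1}/cumulant; case: s => [|e s]; first by rewrite /= subr0.
rewrite [size (e :: s)]/= cumulant_recS; congr (_ - _); apply: eq_usum => a b ab.
have [//|bN] := ifPn; have := size_usum_lt ab bN; rewrite /= => lt_as.
by rewrite cumulant_rec_size.
Qed.

(** The moment-cumulant relation with the block of [x] split off; it is what makes the dual
    polynomial feasible. *)
Lemma usum_cumulant mu nu s : mu [::] = 1 ->
  usum (fun a b => cumulant mu nu a * mu b) s = nu s.
Proof. by move=> mu1; rewrite usum_nilp mu1 mulr1 cumulantE subrK. Qed.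

Lemma perm_cumulant mu nu : perm_invariant mu -> perm_invariant nu ->
  perm_invariant (cumulant mu nu).
Proof.
move=> muP nuP s t; have [m] := ubnP (size s); elim: m s t => // m IH s t sm st.
rewrite !cumulantE (nuP _ _ st); congr (_ - _).
(* [perm_usum] wants invariance for all lists, while induction gives it only for those shorter than
   [m]. The cutoff on [size a] makes the summand invariant everywhere and changes no term that
   occurs. *)
pose F a b := if nilp b || (m <= size a)%N then 0 else cumulant mu nu a * mu b.
have FP u : (size u <= m)%N ->
  usum (fun a b => if nilp b then 0 else cumulant mu nu a * mu b) u = usum F u.
  move=> um; apply: eq_usum => a b ab; rewrite /F; case: ifPn => //= bN.
  by rewrite leqNgt (leq_trans (size_usum_lt ab bN) um).
have tm := perm_size st.
rewrite !FP; [|lia|lia]; apply: perm_usum => // [b a a' aa'|a b b' bb'].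
  rewrite /F (perm_size aa'); case: ifPn => //; rewrite negb_or -ltnNge => /andP[_ am].
  by congr (_ * _); apply: IH => //; rewrite (perm_size aa').
by rewrite /F /nilp (perm_size bb') (muP _ _ bb').
Qed.

Lemma cumulantZ (c : R) mu nu s :
  cumulant (fun s => c ^+ size s * mu s) (fun s => c ^+ (size s).+1 * nu s) s =
  c ^+ (size s).+1 * cumulant mu nu s.
Proof.
have [m] := ubnP (size s); elim: m s => // m IH s sm.
rewrite !cumulantE mulrBr -usumZ; congr (_ - _); apply: eq_usum => a b ab.
have [//|bN] := ifPn; first by rewrite mulr0.
have lt_as := size_usum_lt ab bN.
rewrite IH; last by lia.
rewrite -(perm_size ab) size_cat -addSn exprD; ring.
Qed.

(** Put [n = size s]. By induction a proper split contributes at most [n ^+ size a * nu s]. The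
    binomial theorem sums these to [(n + 1)^n - n^n] times [nu s], and the leading [nu s] is covered
    because [1 <= n^n]. *)
Lemma ler_norm_cumulant mu nu s : (forall s, 0 <= mu s) -> (forall s, 0 <= nu s) ->
  (forall a b t, perm_eq (a ++ b) t -> nu a * mu b <= nu t) ->
  `|cumulant mu nu s| <= (size s).+1%:R ^+ size s * nu s.
Proof.
move=> mu0 nu0 sub; have [m] := ubnP (size s); elim: m s => // m IH s sm.
case: s sm => [_|e s]; first by rewrite /cumulant /= expr0 mul1r ger0_norm.
set t := e :: s; move=> tm; rewrite cumulantE.
pose n := size t; have n1 : 1 <= n%:R :> R by rewrite ler1n.
apply: le_trans (ler_normB _ _) _; rewrite (ger0_norm (nu0 _)).
have : `|usum (fun a b => if nilp b then 0 else cumulant mu nu a * mu b) t| <=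
   nu t * usum (fun a b => if nilp b then 0 else n%:R ^+ size a) t.
  rewrite -usumZ; apply: ler_norm_usum => a b ab.
  have [//|bN] := ifPn; first by rewrite normr0 mulr0.
  have lt_at := size_usum_lt ab bN.
  rewrite normrM (ger0_norm (mu0 _)).
  have le1 := IH a (leq_trans lt_at tm).
  apply: le_trans (ler_wpM2r (mu0 b) le1) _.
  rewrite -mulrA mulrC; apply: ler_pM.
  - by rewrite mulr_ge0.
  - by rewrite exprn_ge0.
  - exact: sub.
  - by apply: lerXn2r; rewrite ?nnegrE // ler_nat.
have := usum_nilp (fun a b => (n%:R : R) ^+ size a) t.
rewrite usum_exp -/n => E; have {E} -> : usum (fun a b => if nilp b then 0 else n%:R ^+ size a) t =
   n.+1%:R ^+ n - n%:R ^+ n :> R by rewrite -natr1 E addrC addKr.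
have : 1 <= n%:R ^+ n :> R by apply: exprn_ege1.
move: (nu0 t); rewrite -/n; move: (`|_|) (nu t) (n.+1%:R ^+ n) (n%:R ^+ n) => a b c d.
nra.
Qed.

(** If no letter satisfying [b] may go left, all of them go right; erasing them there leaves the
    splits of the filtered list. *)
Lemma usum_filter (b : pred T) (F : seq T -> seq T -> R) s :
  usum (fun a1 a2 => if has b a1 then 0 else F a1 (filter (predC b) a2)) s =
  usum F (filter (predC b) s).
Proof.
elim: s F => [|e s IH] F //=; case be: (b e) => /=.
  by rewrite usum0 add0r IH.
by rewrite (IH (fun a1 a2 => F (e :: a1) a2)) (IH (fun a1 a2 => F a1 (e :: a2))).
Qed.

(** The letters satisfying [b] behave as if independent of [x] and of the other letters. In the
    recursion, induction kills every proper split whose left part meets [b]; by [usum_filter] the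
    remaining ones add up to [mu (filter b t) * nu (filter (predC b) t)], which is [nu t], so
    nothing is left for the cumulant. *)
Lemma cumulant_eq0 (b : pred T) mu nu s : perm_invariant mu ->
  mu [::] = 1 ->
  {in [pred a | all [in s] a], forall a,
     mu a = mu (filter (predC b) a) * mu (filter b a)} ->
  {in [pred a | all [in s] a], forall a,
     nu a = nu (filter (predC b) a) * mu (filter b a)} ->
  has b s -> cumulant mu nu s = 0.
Proof.
move=> muP mu1 mub nub.
suff H m t : (size t < m)%N -> all [in s] t -> has b t -> cumulant mu nu t = 0.
  by apply: (H (size s).+1) => //; apply/allP.
elim: m t => // m IH t tm ts bt; rewrite cumulantE nub //.
apply/eqP; rewrite subr_eq0; apply/eqP.
rewrite -(usum_cumulant nu (filter (predC b) t) mu1) -usum_filter mulrC -usumZ.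
apply: eq_usum => a1 a2 a12.
move: (ts); rewrite -(perm_all _ a12) all_cat => /andP[a1s a2s].
have [ba1|nba1] := ifPn.
  rewrite mulr0; case: ifPn => // a2N.
  by rewrite IH ?mul0r //; have := size_usum_lt a12 a2N; lia.
case: ifPn => [/nilP a2N|a2N].
  by move: a12 nba1; rewrite a2N cats0 => /perm_has ->; rewrite bt.
rewrite (mub a2) // mulrCA; congr (_ * _); rewrite [RHS]mulrC; congr (_ * _).
apply: muP; rewrite perm_sym.
move: (perm_filter b a12); rewrite filter_cat.
by move: nba1; rewrite has_filter negbK => /eqP ->; rewrite perm_sym.
Qed.

End Cumulant.

(** * Cumulants of label agreements *)

Section Agreement.
Variables (R : realFieldType) (I J : finType) (k : nat).
Implicit Types (e x : I * J) (s a b : seq (I * J)).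

(* ['I_k.+1] is used as the additive group of integers modulo k + 1, so that the
   labellings satisfying a set of equality constraints form a subgroup. *)
Local Notation labelling := {ffun I + J -> 'I_k.+1}.
Implicit Types z u v : labelling.

Definition agree z e := z (inl e.1) == z (inr e.2).
Definition agree_set s : {set labelling} := [set z | all (agree z) s].
Definition agree_prob s : R := #|agree_set s|%:R / #|{: labelling}|%:R.

Lemma agreeD u v e : agree u e -> agree v e -> agree (u + v) e.
Proof. by rewrite /agree !ffunE => /eqP -> /eqP ->. Qed.

Lemma agreeN u e : agree u e -> agree (- u) e.
Proof. by rewrite /agree !ffunE => /eqP ->. Qed.

Lemma agree_setD u v s : u \in agree_set s -> v \in agree_set s -> u + v \in agree_set s.
Proof.
rewrite !inE => /allP us /allP vs; apply/allP => e es.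
by apply: agreeD; [exact: us | exact: vs].
Qed.

Lemma agree_setN u s : u \in agree_set s -> - u \in agree_set s.
Proof. by rewrite !inE => /allP us; apply/allP => e es; apply/agreeN/us. Qed.

Lemma agree_set_cat a b : agree_set (a ++ b) = agree_set a :&: agree_set b.
Proof. by apply/setP => z; rewrite !inE all_cat. Qed.

Lemma sub_agree_set a b : {subset a <= b} -> agree_set b \subset agree_set a.
Proof.
by move=> ab; apply/subsetP => z; rewrite !inE => /allP zb; apply/allP => e /ab /zb.
Qed.

Let plus (uv : labelling * labelling) : labelling := uv.1 + uv.2.

Let fiber a b (w : labelling) :=
  [set uv in setX (agree_set a) (agree_set b) | plus uv == w].

(** Two decompositions of one sum differ by [(d, - d)] with [d] in both subgroups, so a nonempty
    fiber of addition is a copy of their intersection. *)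
Lemma card_fiber a b u v : u \in agree_set a -> v \in agree_set b ->
  #|fiber a b (u + v)| = #|agree_set (a ++ b)|.
Proof.
move=> ua vb; pose f d : labelling * labelling := (u + d, v - d).
have -> : fiber a b (u + v) = f @: agree_set (a ++ b).
  apply/setP => -[u' v']; rewrite !inE /plus /=; apply/idP/imsetP.
    move=> /andP[/andP[u'a v'b]] /eqP E; exists (u' - u); last first.
      congr (_, _); first by rewrite addrC subrK.
      by rewrite opprB addrA [v + u]addrC -E addrAC subrr add0r.
    have u'A : u' \in agree_set a by rewrite inE.
    have v'B : v' \in agree_set b by rewrite inE.
    have uv : u' - u = v - v'.
      by apply/eqP; rewrite subr_eq addrAC eq_sym subr_eq addrC E addrC eqxx.
    by rewrite agree_set_cat in_setI {2}uv !agree_setD ?agree_setN.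
  move=> [d]; rewrite agree_set_cat in_setI => /andP[da db] [-> ->].
  rewrite addrACA subrr addr0 eqxx andbT.
  have := agree_setD ua da; have := agree_setD vb (agree_setN db).
  by rewrite !inE => -> ->.
by rewrite card_imset // => d d' [/addrI].
Qed.

Lemma card_agree_setX a b :
  (#|agree_set a| * #|agree_set b| = \sum_w #|fiber a b w|)%N.
Proof.
rewrite -cardsX -sum1_card (partition_big plus xpredT) //=.
by apply: eq_bigr => w _; rewrite -sum1_card; apply: eq_bigl => uv; rewrite !inE.
Qed.

Lemma card_labelling_gt0 : 0 < #|{: labelling}|%:R :> R.
Proof. by rewrite ltr0n; apply/card_gt0P; exists 0. Qed.

(** For subgroups, [|A| |B|] is [|A + B|] times the order of the intersection, and [A + B] is at
    most the whole group. *)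
Lemma agree_probM_le a b : agree_prob a * agree_prob b <= agree_prob (a ++ b).
Proof.
rewrite /agree_prob mulf_div -natrM card_agree_setX.
rewrite invfM mulrA ler_pM2r ?invr_gt0 ?card_labelling_gt0 //.
rewrite ler_pdivrMr ?card_labelling_gt0 // -natrM ler_nat.
rewrite mulnC -sum_nat_const; apply: leq_sum => w _.
have [->|[[u v]]] := set_0Vmem (fiber a b w); first by rewrite cards0.
by rewrite !inE /plus /= => /andP[/andP[ua vb] /eqP <-]; rewrite card_fiber ?inE.
Qed.

(** The hypothesis says that the sum of the two subgroups is the whole group, so that no fiber of
    addition is empty. *)
Lemma agree_probM a b :
  (forall w, exists2 u, u \in agree_set a & w - u \in agree_set b) ->
  agree_prob (a ++ b) = agree_prob a * agree_prob b.
Proof.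
move=> ab; rewrite /agree_prob mulf_div -natrM card_agree_setX.
rewrite (eq_bigr (fun _ => #|agree_set (a ++ b)|)) => [|w _].
  rewrite sum_nat_const natrM -mulf_div divff ?mul1r ?gt_eqF //.
  exact: card_labelling_gt0.
have [u ua wb] := ab w.
by rewrite -[w in LHS](subrK u) addrC card_fiber.
Qed.

Lemma agree_prob_ge0 s : 0 <= agree_prob s.
Proof. by rewrite divr_ge0. Qed.

Lemma agree_prob_nil : agree_prob [::] = 1.
Proof.
have -> : agree_prob [::] = #|{: labelling}|%:R / #|{: labelling}|%:R.
  by rewrite /agree_prob -cardsT; congr (#|pred_of_set _|%:R / _); apply/setP => z; rewrite !inE.
by rewrite divff // gt_eqF // card_labelling_gt0.
Qed.

Lemma eq_mem_agree_prob a b : a =i b -> agree_prob a = agree_prob b.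
Proof.
move=> ab; rewrite /agree_prob; congr (_%:R / _); apply: eq_card => z.
by rewrite !inE (eq_all_r ab).
Qed.

Lemma perm_agree_prob : perm_invariant agree_prob.
Proof. by move=> a b /perm_mem; apply: eq_mem_agree_prob. Qed.

(* The connected component argument and the leaf argument are both instances: the
   constraints [x :: filter (predC b) s] and [filter b s] must jointly be
   transversal subgroups. *)
Lemma cumulant_agree_eq0 (b : pred (I * J)) x s : has b s ->
  (forall w, exists2 u, u \in agree_set (x :: filter (predC b) s) &
      w - u \in agree_set (filter b s)) ->
  cumulant agree_prob (fun s => agree_prob (x :: s)) s = 0.
Proof.
move=> bs dec; apply: (@cumulant_eq0 _ _ b _ _ _ perm_agree_prob agree_prob_nil) => //.
  move=> a /allP asub; rewrite -agree_probM => [|w].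
    by apply: perm_agree_prob; rewrite perm_sym perm_catC perm_filterC.
  have [u us wus] := dec w; exists u.
    apply: (subsetP (sub_agree_set _)) us => e; rewrite mem_filter => /andP[be /asub es].
    by rewrite inE mem_filter be [_ \in _]es orbT.
  apply: (subsetP (sub_agree_set _)) wus => e; rewrite !mem_filter => /andP[-> /asub //].
move=> a /allP asub; rewrite -agree_probM => [|w].
  apply: perm_agree_prob; rewrite cat_cons perm_cons.
  by rewrite perm_sym perm_catC perm_filterC.
have [u us wus] := dec w; exists u.
  apply: (subsetP (sub_agree_set _)) us => e; rewrite !inE => /predU1P[->|]; rewrite ?eqxx //.
  by rewrite !mem_filter => /andP[-> /asub ->]; rewrite orbT.
by apply: (subsetP (sub_agree_set _)) wus => e; rewrite !mem_filter => /andP[-> /asub //].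
Qed.

Lemma cumulant_agree_bound x s :
  `|cumulant agree_prob (fun s => agree_prob (x :: s)) s| <=
    (size s).+1%:R ^+ size s * agree_prob (x :: s).
Proof.
apply: ler_norm_cumulant => [a|a|a b t ab]; try exact: agree_prob_ge0.
apply: le_trans (agree_probM_le _ _) _.
by rewrite (@perm_agree_prob _ (x :: t)) //= perm_cons.
Qed.

End Agreement.

Lemma card_image_le_half (T : eqType) (I : finType) (f : T -> I) (l : seq T) :
  {in l, forall e, 1 < count (fun e' => f e' == f e) l}%N ->
  (#|[set i in map f l]|.*2 <= size l)%N.
Proof.
move=> l2; have -> : size l = (\sum_i count (fun e => f e == i) l)%N.
  elim: l {l2} => [|e l IH] /=; first by rewrite big1.
  by rewrite big_split /= -IH (bigD1 (f e)) //= eqxx big1 ?addn0 // => i /negPf; rewrite eq_sym => ->.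
rewrite -muln2 -sum_nat_const big_mkcond /=; apply: leq_sum => i _.
by rewrite inE; case: mapP => // -[e el ->]; exact: l2.
Qed.

(** * Leaves, degrees and connectedness of the multigraph [x :: s] *)

Section AgreementCumulant.
Variables (R : realFieldType) (I J : finType) (k : nat).
Implicit Types (e x : I * J) (s : seq (I * J)).

Local Notation labelling := {ffun I + J -> 'I_k.+1}.
Local Notation prob := (agree_prob R k).
Local Notation kappa x := (cumulant prob (fun s => prob (x :: s))).

Definition rows s : {set I} := [set i in map fst s].
Definition cols s : {set J} := [set j in map snd s].

(** A vertex [v] of degree one can be relabelled to satisfy its only edge without disturbing the
    others. If that edge is [x], then [x] is independent of all of [s]; otherwise it is a letter of
    [s] that splits off. Multiplicities count: the ends of a doubled edge are not leaves. *)
Lemma cumulant_agree_leaf_eq0 x s (v : I + J) : s != [::] ->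
  (count (fun e => (inl e.1 == v) || (inr e.2 == v)) (x :: s) = 1)%N ->
  kappa x s = 0.
Proof.
pose touch e := (inl e.1 == v) || (inr e.2 == v); rewrite -[X in count X]/touch => s0 count1.
(* [bump w e] is supported at [v] and carries the defect of [w] along [e]: subtracting it from [w]
   makes [e] agree, and by itself it satisfies every edge that avoids [v]. *)
pose other e : I + J := if v is inl _ then inr e.2 else inl e.1.
pose bump (w : labelling) e : labelling :=
  [ffun u => if u == v then w v - w (other e) else 0].
have bump_avoid w e e' : ~~ touch e' -> agree (bump w e) e'.
  by rewrite /agree /touch !ffunE negb_or => /andP[/negPf -> /negPf ->].
have bump_touch w e : touch e -> agree (w - bump w e) e.
  rewrite /agree /touch !ffunE /other; case: v {count1 other bump touch bump_avoid} => [i|j].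
    by rewrite orbF => /eqP ->; rewrite eqxx /= subr0 opprB addrC subrK.
  by move=> /= /eqP ->; rewrite eqxx /= subr0 opprB addrC subrK.
have [xv|xv] := boolP (touch x).
  have nos : count touch s = 0%N by move: count1; rewrite /= xv; lia.
  apply: (@cumulant_agree_eq0 _ _ _ _ predT).
    by rewrite has_predT lt0n size_eq0.
  move=> w; exists (w - bump w x).
    rewrite inE /= bump_touch //=.
    by apply/allP => e; rewrite mem_filter.
  rewrite subKr filter_predT inE; apply/allP => e es; apply: bump_avoid.
  apply/negP => te; have : has touch s by apply/hasP; exists e.
  by rewrite has_count nos.
have scount : count touch s = 1%N by move: count1; rewrite /= (negPf xv).
have /hasP[e0 e0s te0] : has touch s by rewrite has_count scount.
apply: (@cumulant_agree_eq0 _ _ _ _ (pred1 e0)).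
  by apply/hasP; exists e0 => //=; rewrite eqxx.
move=> w; exists (bump w e0).
  rewrite inE /= bump_avoid //=; apply/allP => e; rewrite mem_filter => /andP[/= ee0 es].
  apply: bump_avoid; apply/negP => te.
  have : (count_mem e0 s + count_mem e s <= count touch s)%N.
    rewrite -count_predUI [X in (_ + X)%N](@eq_count _ _ pred0) ?count_pred0 ?addn0.
      by apply: sub_count => y /= /orP[] /eqP ->.
    by move=> y /=; apply/negP => /andP[/eqP ->]; rewrite eq_sym (negPf ee0).
  have := e0s; have := es; rewrite -!has_pred1 !has_count scount; lia.
rewrite inE; apply/allP => e; rewrite mem_filter => /andP[/eqP -> _]; exact: bump_touch.
Qed.

Lemma cumulant_agree_degree x s : s != [::] -> kappa x s != 0 ->
  (#|rows (x :: s)|.*2 <= (size s).+1)%N /\ (#|cols (x :: s)|.*2 <= (size s).+1)%N.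
Proof.
move=> s0 ks; split; apply: (@card_image_le_half _ _ _ (x :: s)) => e es;
  rewrite ltn_neqAle -has_count; apply/andP; split; try (by apply/hasP; exists e => //=);
  apply: contra ks => /eqP c1; apply/eqP.
  apply: (@cumulant_agree_leaf_eq0 x s (inl e.1)) => //; rewrite c1.
  by apply: eq_count => e'; rewrite orbF.
apply: (@cumulant_agree_leaf_eq0 x s (inr e.2)) => //; rewrite c1.
Qed.

Lemma card_constant_on (W : {set I + J}) (v0 : I + J) :
  (#|[set z : labelling | [forall v in W, z v == z v0]]| <= k.+1 * k.+1 ^ #|~: W|)%N.
Proof.
pose F c v : pred 'I_k.+1 := if v \in W then pred1 c else predT.
have Fcard c : #|family (F c)| = (k.+1 ^ #|~: W|)%N.
  rewrite card_family foldrE big_map big_enum /= -prod_nat_const [RHS]big_mkcond.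
  apply: eq_bigr => v _; rewrite inE /F; case: (v \in W) => /=; first by rewrite card1.
  by rewrite card_ord.
apply: (@leq_trans (\sum_(c < k.+1) #|family (F c)|)).
  rewrite -sum1_card; under [X in (_ <= X)%N]eq_bigr do rewrite -sum1_card big_mkcond /=.
  rewrite exchange_big [leqLHS]big_mkcond /=; apply: leq_sum => z _.
  case: ifP => //; rewrite inE => /forall_inP zW.
  rewrite (bigD1 (z v0)) //= ifT //; apply/familyP => v; rewrite /F.
  by case: ifP => // vW; rewrite inE zW.
by under eq_bigr do rewrite Fcard; rewrite sum_nat_const card_ord.
Qed.

(* [U] is the set of vertices forced to carry the label of [x.1]: no edge leaves it,
   so the edges outside it are independent of the edges inside it. *)
Lemma cumulant_agree_connected x s : kappa x s != 0 ->
  prob (x :: s) <= k.+1%:R ^- (#|rows (x :: s)| + #|cols (x :: s)|).-1.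
Proof.
move=> ks; pose U v := [forall z in agree_set k (x :: s), z v == z (inl x.1)].
have UE e : e \in x :: s -> U (inl e.1) = U (inr e.2).
  move=> es; apply: eq_forallb => z; rewrite inE; case: allP => //= /(_ _ es).
  by rewrite /agree => /eqP ->.
have Ux : U (inl x.1) by apply/forall_inP.
have sU : ~~ has (fun e => ~~ U (inl e.1)) s.
  apply: contra ks => sU; apply/eqP; apply: (@cumulant_agree_eq0 R I J k _ x s sU) => w.
  pose u : labelling := [ffun v => if U v then 0 else w v]; exists u.
    rewrite inE; apply/allP => e; rewrite inE => /predU1P[->|].
      by rewrite /agree !ffunE -UE ?mem_head // Ux.
    rewrite mem_filter /= negbK => /andP[Ue es].
    by rewrite /agree !ffunE -UE ?Ue // inE es orbT.
  rewrite inE; apply/allP => e; rewrite mem_filter => /andP[/negPf Ue es].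
  by rewrite /agree !ffunE -UE ?Ue ?subrr // inE es orbT.
have {}sU e : e \in x :: s -> U (inl e.1).
  by rewrite inE => /predU1P[->//|es]; move: sU => /hasPn/(_ _ es); rewrite negbK.
(* All vertices of [x :: s] lie in [U], so an agreeing labelling is constant on [W]: one common
   label replaces [#|W|] free ones, whence the exponent [#|W|.-1]. *)
pose W : {set I + J} := inl @: rows (x :: s) :|: inr @: cols (x :: s).
have cW : #|W| = (#|rows (x :: s)| + #|cols (x :: s)|)%N.
  rewrite cardsU !card_imset; try by move=> ? ? [].
  rewrite [X in (_ - X)%N](_ : _ = 0)%N ?subn0 //.
  by apply: eq_card0 => v; rewrite inE; apply/negP => /andP[/imsetP[? _ ->] /imsetP[]].
have W0 : (0 < #|W|)%N.
  by apply/card_gt0P; exists (inl x.1); rewrite inE imset_f // inE mem_head.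
have le1 : (#|agree_set k (x :: s)| <= k.+1 * k.+1 ^ #|~: W|)%N.
  apply: leq_trans (card_constant_on W (inl x.1)); apply: subset_leq_card.
  apply/subsetP => z zs; rewrite inE; apply/forall_inP => v vW.
  suff /forall_inP/(_ _ zs) : U v by [].
  move: vW; rewrite inE => /orP[] /imsetP[i]; rewrite inE => /mapP[e es -> ->].
    exact: sU.
  by rewrite -UE ?sU.
rewrite -cW /agree_prob card_ffun card_ord -(cardsC W) expnD.
rewrite ler_pdivrMr ?ltr0n ?muln_gt0 ?expn_gt0 //.
rewrite natrM mulrA -[X in _ ^- X.-1](prednK W0) /=.
rewrite -{2}(prednK W0) expnS natrM natrX [_ ^- _ * _]mulrC mulfK.
  by rewrite -natrM ler_nat.
by rewrite expf_neq0 // pnatr_eq0.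
Qed.

End AgreementCumulant.

(** * The energy bound *)

Fixpoint ssum (T : finType) (V : zmodType) (m : nat) (F : seq T -> V) : V :=
  if m is m'.+1 then \sum_e ssum m' (fun s => F (e :: s)) else F [::].

Section SsumZmod.
Variables (T : finType) (V : zmodType).
Implicit Types (F G : seq T -> V).

Lemma eq_ssum m F G : (forall s, size s = m -> F s = G s) -> ssum m F = ssum m G.
Proof.
elim: m F G => [|m IH] F G FG /=; first exact: FG.
by apply: eq_bigr => e _; apply: IH => s sm; apply: FG; rewrite /= sm.
Qed.

Lemma ssumD m F G : ssum m (fun s => F s + G s) = ssum m F + ssum m G.
Proof.
elim: m F G => [|m IH] F G //=; rewrite -big_split /=.
by apply: eq_bigr => e _; rewrite IH.
Qed.

Lemma ssum_morph (U : zmodType) (f : V -> U) m F :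
  f 0 = 0 -> {morph f : p q / p + q} -> f (ssum m F) = ssum m (fun s => f (F s)).
Proof.
move=> f0 fD; elim: m F => [|m IH] F //=; rewrite (big_morph f fD f0).
by apply: eq_bigr => e _; rewrite IH.
Qed.

End SsumZmod.

Section SsumNum.
Variables (T : finType) (R : realFieldType).
Implicit Types (F G : seq T -> R).

Lemma ler_ssum m F G : (forall s, size s = m -> F s <= G s) -> ssum m F <= ssum m G.
Proof.
elim: m F G => [|m IH] F G FG /=; first exact: FG.
by apply: ler_sum => e _; apply: IH => s sm; apply: FG; rewrite /= sm.
Qed.

Lemma ssumZ m c F : ssum m (fun s => c * F s) = c * ssum m F.
Proof.
elim: m F => [|m IH] F //=; rewrite mulr_sumr.
by apply: eq_bigr => e _; rewrite IH.
Qed.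

End SsumNum.

Fixpoint rising (a m : nat) : nat := if m is m'.+1 then a.+1 * rising a.+1 m' else 1.

Lemma leq_rising a b m : (a <= b)%N -> (rising a m <= rising b m)%N.
Proof. by elim: m a b => //= m IH a b ab; apply: leq_mul => //; apply: IH. Qed.

Lemma rising_fact a m : (a`! * rising a m = (a + m)`!)%N.
Proof.
elim: m a => [|m IH] a /=; first by rewrite muln1 addn0.
by rewrite mulnA [(_ * a.+1)%N]mulnC -factS IH addSnnS.
Qed.

Section CountingWeight.
Variables (R : realFieldType) (I J : finType) (q : R).
Hypotheses (q_ge0 : 0 <= q) (Iq : #|I|%:R * q <= 1) (Jq : #|J|%:R * q <= 1).

Lemma sum_expr_cardU1 (K : finType) (A : {set K}) : #|K|%:R * q <= 1 ->
  \sum_i q ^+ #|i |: A| <= #|A|.+1%:R * q ^+ #|A|.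
Proof.
move=> Kq; have qA : 0 <= q ^+ #|A| by apply: exprn_ge0.
rewrite (bigID [in A]) /= (eq_bigr (fun _ => q ^+ #|A|)) => [|i iA]; last first.
  by rewrite (setUidPr _) ?sub1set.
rewrite [X in _ + X](eq_bigr (fun _ => q * q ^+ #|A|)) => [|i iA]; last first.
  by rewrite cardsU1 iA exprS.
rewrite !sumr_const -natr1 mulrDl mul1r mulr_natl lerD2l.
rewrite -mulr_natl mulrA; apply: ler_piMl => //.
by apply: le_trans Kq; rewrite ler_wpM2r // ler_nat max_card.
Qed.

(** Edges are added one at a time. The row of a new edge is one of the [#|A|] old ones, at no cost,
    or one of at most [#|I|] new ones, at cost [q] each and at most 1 in total: a factor [#|A|.+1],
    and likewise for columns. Both sets grow by at most one per edge, hence the rising products. *)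
Lemma ssum_weight m (A : {set I}) (B : {set J}) :
  ssum m (fun s => q ^+ (#|A :|: rows s| + #|B :|: cols s|)) <=
  (rising #|A| m * rising #|B| m)%:R * q ^+ (#|A| + #|B|).
Proof.
elim: m A B => [|m IH] A B /=.
  have -> : A :|: rows ([::] : seq (I * J)) = A by apply/setP => i; rewrite !inE in_nil orbF.
  have -> : B :|: cols ([::] : seq (I * J)) = B by apply/setP => i; rewrite !inE in_nil orbF.
  by rewrite muln1 mulr1n mul1r.
pose c := (rising #|A|.+1 m * rising #|B|.+1 m)%N.
apply: (@le_trans _ _ (\sum_(e : I * J) c%:R * (q ^+ #|e.1 |: A| * q ^+ #|e.2 |: B|))).
  apply: ler_sum => e _; under eq_ssum => s _.
    rewrite (_ : A :|: rows (e :: s) = (e.1 |: A) :|: rows s); last first.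
      by apply/setP => i; rewrite !inE orbA [_ || (i == _)]orbC.
    rewrite (_ : B :|: cols (e :: s) = (e.2 |: B) :|: cols s); last first.
      by apply/setP => i; rewrite !inE orbA [_ || (i == _)]orbC.
    over.
  apply: le_trans (IH _ _) _; rewrite exprD; apply: ler_wpM2r.
    by rewrite mulr_ge0 ?exprn_ge0.
  by rewrite ler_nat; apply: leq_mul; apply: leq_rising; rewrite cardsU1 -add1n leq_add2r leq_b1.
rewrite -mulr_sumr -(pair_bigA _ (fun i j => q ^+ #|i |: A| * q ^+ #|j |: B|)) /=.
under eq_bigr do rewrite -mulr_sumr.
rewrite -mulr_suml.
have := ler_pM _ _ (sum_expr_cardU1 A Iq) (sum_expr_cardU1 B Jq).
move=> /(_ (sumr_ge0 _ _) (sumr_ge0 _ _)) SIJ.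
have {SIJ} := SIJ (fun i _ => exprn_ge0 _ q_ge0) (fun i _ => exprn_ge0 _ q_ge0).
move=> /(ler_wpM2l (ler0n R c)) /le_trans; apply.
by rewrite /c !natrM exprD; lra.
Qed.

End CountingWeight.

(** Trades one of the two factorials of the graph count for a power. It fails at [m = 1], a length
    that [ssum_support_weight] treats by hand. *)
Lemma factS_le_expn m : (1 < m -> m.+1`! <= m ^ (2 * m))%N.
Proof.
elim: m => // m IH; rewrite leq_eqVlt => /predU1P[<- //|m2].
rewrite factS; apply: leq_trans (leq_mul (leqnn _) (IH m2)) _.
rewrite mulnS expnD; apply: leq_mul; first by rewrite expnS expn1; nia.
by rewrite leq_exp2r //; lia.
Qed.

(** The partial sum is the value of the full series minus an explicit nonnegative tail. *)
Lemma sum_arith_geometric (R : realFieldType) (r : R) (D : nat) : 0 <= r -> r < 1 ->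
  \sum_(1 <= m < D.+1) m.+1%:R * r ^+ m <= r * (2 - r) / (1 - r) ^+ 2.
Proof.
move=> r0 r1; rewrite ler_pdivlMr ?exprn_gt0 ?subr_gt0 //.
have -> : (\sum_(1 <= m < D.+1) m.+1%:R * r ^+ m) * (1 - r) ^+ 2 =
    r * (2 - r) - r ^+ D.+1 * (D.+1%:R * (1 - r) + 1).
  elim: D => [|D IH]; first by rewrite big_geq // mul0r expr1; ring.
  rewrite big_nat_recr //= mulrDl IH -[D.+2%:R]natr1 !exprS; ring.
by rewrite lerBlDr lerDl mulr_ge0 ?exprn_ge0 // addr_ge0 // mulr_ge0 // subr_ge0 ltW.
Qed.

Section Energy.
Variables (R : realFieldType) (I J : finType) (k : nat) (x : I * J) (q : R).
Hypotheses (q_gt0 : 0 < q) (Iq : #|I|%:R * q <= 1) (Jq : #|J|%:R * q <= 1).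

Local Notation prob := (agree_prob R k).
Local Notation kappa := (cumulant prob (fun s => prob (x :: s))).
Local Notation nv s := (#|rows (x :: s)| + #|cols (x :: s)|)%N.

Lemma nv_gt1 s : (1 < nv s)%N.
Proof.
have r0 : (0 < #|rows (x :: s)|)%N by apply/card_gt0P; exists x.1; rewrite inE mem_head.
have c0 : (0 < #|cols (x :: s)|)%N by apply/card_gt0P; exists x.2; rewrite inE mem_head.
lia.
Qed.

Lemma ssum_support_weight m : (0 < m)%N ->
  ssum m (fun s => if kappa s == 0 then 0 else q ^+ nv s) <=
  (m.+1`! * m ^ (2 * m))%:R * q ^+ 2.
Proof.
have q0 := ltW q_gt0; case: m => // -[_|m _].
  (* For length one the degree bound allows a single row and a single column, so [e = x]: only the
     doubled edge survives. *)
  apply: (@le_trans _ _ (q ^+ 2)); last first.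
    by rewrite -[leLHS]mul1r ler_wpM2r ?exprn_ge0 // ler1n.
  rewrite /= (bigD1 x) //= big1 ?addr0 => [|e ex].
    case: ifP => _; first by rewrite exprn_ge0.
    have -> : rows [:: x; x] = [set x.1] by apply/setP => i; rewrite !inE orbb.
    have -> : cols [:: x; x] = [set x.2] by apply/setP => i; rewrite !inE orbb.
    by rewrite !cards1.
  case: eqVneq => // /cumulant_agree_degree[] //=.
  rewrite -[1.+1]/(1.*2) !leq_double => r1 c1; case/eqP: ex.
  have rE i : i \in rows [:: x; e] -> i = x.1.
    by apply: (card_le1_eqP r1); rewrite inE mem_head.
  have cE i : i \in cols [:: x; e] -> i = x.2.
    by apply: (card_le1_eqP c1); rewrite inE mem_head.
  have := rE e.1; have := cE e.2; rewrite !inE !eqxx !orbT => /(_ isT) + /(_ isT).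
  by case: (e) => a b /= -> ->; case: (x).
apply: le_trans (_ : ((m.+3)`! * (m.+3)`!)%:R * q ^+ 2 <= _); last first.
  apply: ler_wpM2r; first by rewrite exprn_ge0.
  by rewrite ler_nat leq_mul // factS_le_expn.
(* The count starts from the two ends of [x], so both rising products are the factorial of
   [m.+3]. *)
have := ssum_weight q0 Iq Jq m.+2 [set x.1] [set x.2]; rewrite !cards1.
rewrite -(mul1n (rising 1 m.+2)) (rising_fact 1) add1n; apply: le_trans.
apply: ler_ssum => s _.
rewrite (_ : [set x.1] :|: rows s = rows (x :: s)); last by apply/setP => i; rewrite !inE.
rewrite (_ : [set x.2] :|: cols s = cols (x :: s)); last by apply/setP => i; rewrite !inE.
by case: ifP => // _; rewrite exprn_ge0.
Qed.

Variables (lambda r : R) (D : nat).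
Hypotheses (r0 : 0 <= r) (r1 : r < 1).
Hypothesis hsnr : lambda ^+ 2 <=
  r / ((D * (D + 1)) ^ 2)%:R * Num.min 1 ((k.+1 ^ 2)%:R * q).

Let kappaL s := cumulant (fun s => lambda ^+ size s * prob s)
  (fun s => lambda ^+ (size s).+1 * prob (x :: s)) s.

(** The powers of [k.+1] from connectedness and from the bound on [lambda] cancel exactly. What
    remains is [q] to the number of edges of a spanning tree, written as [q ^+ nv s / q] to fit the
    graph count. *)
Lemma kappaL_sqr_le s : (0 < size s)%N ->
  kappaL s ^+ 2 <= lambda ^+ 2 * (r / ((D * (D + 1)) ^ 2)%:R) ^+ size s *
    (size s).+1%:R ^+ (2 * size s) / q * (if kappa s == 0 then 0 else q ^+ nv s).
Proof.
set m := size s; set r' := r / _ => m0.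
have q0 := ltW q_gt0; have r'0 : 0 <= r' by rewrite divr_ge0.
rewrite /kappaL cumulantZ -/m; case: eqVneq => [->|ks].
  by rewrite mulr0 expr0n /= mulr0.
have s0 : s != [::] by rewrite -size_eq0 -lt0n.
have [rs cs] := cumulant_agree_degree s0 ks.
have conn := cumulant_agree_connected ks.
have bnd := cumulant_agree_bound R k x s.
set n := nv s in conn *; have n1 : (1 < n)%N := nv_gt1 s.
have nm : (n.-1 <= m)%N by rewrite /n in n1 *; rewrite -/m in rs cs; lia.
have k0 : 0 < (k.+1%:R : R) by rewrite ltr0n.
have kap2 : kappa s ^+ 2 <= m.+1%:R ^+ (2 * m) * (k.+1%:R ^- n.-1) ^+ 2.
  rewrite mulnC exprM -exprMn -real_normK ?num_real //.
  apply: lerXn2r; rewrite ?nnegrE ?mulr_ge0 ?invr_ge0 ?exprn_ge0 //.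
  by apply: le_trans bnd _; rewrite ler_wpM2l ?exprn_ge0.
have kq0 : 0 <= (k.+1 ^ 2)%:R * q by rewrite mulr_ge0.
have mu0 : 0 <= Num.min 1 ((k.+1 ^ 2)%:R * q) by rewrite le_min ler01.
(* The minimum is at most 1, so its exponent may drop from [m] to [n.-1]; only then is it replaced
   by its second argument, which may exceed 1. *)
have lam : lambda ^+ (2 * m) <= r' ^+ m * ((k.+1 ^ 2)%:R * q) ^+ n.-1.
  rewrite exprM; apply: (@le_trans _ _ ((r' * Num.min 1 ((k.+1 ^ 2)%:R * q)) ^+ m)).
    by apply: lerXn2r; rewrite ?nnegrE ?sqr_ge0 // mulr_ge0.
  rewrite exprMn ler_wpM2l ?exprn_ge0 //.
  apply: (@le_trans _ _ (Num.min 1 ((k.+1 ^ 2)%:R * q) ^+ n.-1)).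
    by rewrite ler_wiXn2l // ge_min lexx.
  by apply: lerXn2r; rewrite ?nnegrE // ge_min lexx orbT.
have -> : (lambda ^+ m.+1 * kappa s) ^+ 2 = lambda ^+ 2 * (lambda ^+ (2 * m) * kappa s ^+ 2).
  by rewrite exprMn mulrA -exprD -exprM mulnC mulnS.
move: (lambda ^+ 2) (sqr_ge0 lambda) => L L0.
rewrite -!mulrA; apply: (ler_wpM2l L0).
have lam0 : 0 <= lambda ^+ (2 * m) by rewrite exprM exprn_ge0 ?sqr_ge0.
apply: le_trans (ler_pM lam0 (sqr_ge0 _) lam kap2) _.
have -> : q ^+ n = q * q ^+ n.-1 by rewrite -exprS prednK // ltnW.
rewrite mulKf ?gt_eqF // [(_ * q) ^+ _]exprMn [(k.+1 ^ 2)%:R]natrX.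
have -> : (k.+1%:R ^- n.-1) ^+ 2 = ((k.+1%:R : R) ^+ 2 ^+ n.-1)^-1.
  by rewrite exprVn -!exprM mulnC.
have : (k.+1%:R : R) ^+ 2 ^+ n.-1 != 0 by rewrite !expf_neq0 // gt_eqF.
move: (_ ^+ 2 ^+ n.-1) => c c0.
by rewrite le_eqVlt; apply/orP; left; apply/eqP; move: (r' ^+ m) => c'; field.
Qed.

Lemma energy_bound : 
  \sum_(1 <= m < D.+1) m`!%:R^-1 * ssum m (fun s => kappaL s ^+ 2) <=
  r * (2 - r) / (1 - r) ^+ 2 * lambda ^+ 2 * q.
Proof.
have q0 := ltW q_gt0.
apply: (@le_trans _ _ (\sum_(1 <= m < D.+1) m.+1%:R * r ^+ m * (lambda ^+ 2 * q))); last first.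
  rewrite -mulr_suml -mulrA; apply: ler_wpM2r; first by rewrite mulr_ge0 ?sqr_ge0.
  exact: sum_arith_geometric.
rewrite big_nat_cond [leRHS]big_nat_cond.
apply: ler_sum => m /andP[/andP[m0 mD] _].
set r' := r / ((D * (D + 1)) ^ 2)%:R.
have r'0 : 0 <= r' by rewrite divr_ge0.
pose C := lambda ^+ 2 * r' ^+ m * m.+1%:R ^+ (2 * m) / q.
have C0 : 0 <= C by rewrite /C divr_ge0 // mulr_ge0 ?exprn_ge0 // mulr_ge0 ?sqr_ge0 ?exprn_ge0.
rewrite mulrC ler_pdivrMr ?ltr0n ?fact_gt0 //.
apply: (@le_trans _ _ (C * ((m.+1`! * m ^ (2 * m))%:R * q ^+ 2))).
  apply: le_trans (ler_wpM2l C0 (ssum_support_weight m0)).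
  rewrite -ssumZ; apply: ler_ssum => s sm; rewrite /C -sm; apply: kappaL_sqr_le.
  by rewrite sm.
have D0 : (0 < D)%N by lia.
(* Here [m <= D] enters: each of the [m] factors [r'] pays for one [m ^ 2] of the graph count and
   one [m.+1 ^ 2] of the cumulant bound. *)
have r'r : r' * (m ^ 2 * m.+1 ^ 2)%:R <= r.
  rewrite /r' mulrAC ler_pdivrMr ?ltr0n ?expn_gt0 ?muln_gt0 ?D0 ?addn1 //.
  by rewrite ler_wpM2l // ler_nat expnMn leq_mul // leq_exp2r.
rewrite factS; have -> : C * ((m.+1 * m`! * m ^ (2 * m))%:R * q ^+ 2) =
    (r' * (m ^ 2 * m.+1 ^ 2)%:R) ^+ m * (m.+1%:R * (lambda ^+ 2 * q) * m`!%:R).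
  rewrite /C !natrM !natrX !exprM !exprMn; field; by rewrite gt_eqF.
rewrite [leRHS](_ : _ = r ^+ m * (m.+1%:R * (lambda ^+ 2 * q) * m`!%:R)); last by ring.
apply: ler_wpM2r; first by rewrite mulr_ge0 // mulr_ge0 // mulr_ge0 // sqr_ge0.
by apply: lerXn2r; rewrite ?nnegrE // mulr_ge0.
Qed.

End Energy.

(** * Hermite polynomials and weak duality *)

Section Hermite.
Variables (R : realFieldType) (T : finType) (A : comAlgType R).
Variables (X : T -> A) (d : T -> {linear A -> A}).
Hypothesis dM : forall e p q, d e (p * q) = d e p * q + p * d e q.
Hypothesis dX : forall e f, d e (X f) = (e == f)%:R.
Hypothesis dC : forall e f p, d e (d f p) = d f (d e p).
Implicit Types (m : T -> R) (e f : T) (s u : seq T) (kap : seq T -> R).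

(* Multivariate Hermite polynomial of index the multiset [s], in the variable
   [m + X]: as [X e - d e] is adjoint to [d e] for the standard Gaussian law, its
   expectation is the monomial [\prod_(e <- s) m e]. *)
Fixpoint herm m s : A :=
  if s is e :: s' then (X e + m e *: 1) * herm m s' - d e (herm m s') else 1.

Definition mono m s : R := \prod_(e <- s) m e.

Lemma d1 e : d e 1 = 0.
Proof. by apply: (addrI (d e 1)); rewrite addr0 -{3}[1]mulr1 dM mulr1 mul1r. Qed.

(** Formal derivative: each letter is deleted in turn, with coefficient 1 if it is [e] and 0
    otherwise. The list does not involve the shift [m], so one combination of Hermite polynomials
    serves all shifts. *)
Fixpoint dherm e u : seq (R * seq T) :=
  if u is f :: u' then
    ((e == f)%:R, u') :: [seq (c.1, f :: c.2) | c <- dherm e u'] else [::].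

Lemma dhermE e u m : d e (herm m u) = \sum_(c <- dherm e u) c.1 *: herm m c.2.
Proof.
elim: u => [|f u IH] /=; first by rewrite big_nil d1.
rewrite big_cons big_map /= linearB /= dM raddfD /= linearZ /= d1 scaler0 addr0 dX.
rewrite dC IH -addrA; congr (_ + _).
  by case: (e == f); rewrite ?scale1r ?mul1r // scale0r mul0r.
rewrite linear_sum mulr_sumr -sumrB; apply: eq_bigr => c _.
by rewrite linearZ /= -scalerAr -scalerBr.
Qed.

Lemma size_dherm e u : all (fun c => (size c.2).+1 == size u) (dherm e u).
Proof.
elim: u => //= f u IH; rewrite eqxx /= all_map.
by apply: sub_all IH => c /= /eqP ->.
Qed.

(** Each of the [j.+1] positions may hold the deleted letter, and by symmetry of [kap] all
    contribute the same sum. The induction peels off the first letter [f] and commutes [d e] past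
    [d f]. *)
Lemma d_ssum_herm e j m kap : perm_invariant kap ->
  d e (ssum j.+1 (fun s => kap s *: herm m s)) =
  j.+1%:R *: ssum j (fun s => kap (e :: s) *: herm m s).
Proof.
elim: j kap => [|j IH] kap kapP.
  rewrite scale1r -[LHS]/(d e (\sum_f kap [:: f] *: herm m [:: f])) linear_sum.
  have E f : d e (kap [:: f] *: herm m [:: f]) = kap [:: f] *: (e == f)%:R.
    by rewrite linearZ dhermE /= big_seq1 /= scaler_nat.
  rewrite (eq_bigr _ (fun f _ => E f)) (bigD1 e) //= big1 => [|f fe].
    by rewrite eqxx addr0.
  by rewrite eq_sym (negPf fe) scaler0.
have HS f (i : nat) (kap' : seq T -> R) : ssum i (fun s => kap' s *: herm m (f :: s)) =
    (X f + m f *: 1) * ssum i (fun s => kap' s *: herm m s) -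
    d f (ssum i (fun s => kap' s *: herm m s)).
  rewrite (ssum_morph _ _ (mulr0 (X f + m f *: 1)) (mulrDr _)).
  rewrite (ssum_morph _ _ (raddf0 (d f)) (raddfD _)).
  rewrite (ssum_morph _ _ (oppr0 A) (@opprD A)) -ssumD.
  by apply: eq_ssum => s _; rewrite /= linearZ /= scalerBr scalerAr.
have E f : d e (ssum j.+1 (fun s => kap (f :: s) *: herm m (f :: s))) =
    (e == f)%:R * ssum j.+1 (fun s => kap (f :: s) *: herm m s) +
    j.+1%:R *: ssum j (fun s => kap [:: e, f & s] *: herm m (f :: s)).
  rewrite (HS f j.+1 (fun s => kap (f :: s))) linearB [LHS]/= dM raddfD [LHS]/= linearZ [LHS]/= d1 scaler0 addr0 dX.
  rewrite dC (IH (fun s => kap (f :: s))); last exact: perm_invariant_cons.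
  have -> : ssum j (fun s => kap [:: f, e & s] *: herm m s) =
      ssum j (fun s => kap [:: e, f & s] *: herm m s).
    by apply: eq_ssum => s _; congr (_ *: _); apply: kapP; rewrite (perm_catCA [:: f] [:: e]).
  by rewrite linearZ -addrA -scalerAr -scalerBr -(HS f j (fun s => kap [:: e, f & s])).
rewrite -[LHS]/(d e (\sum_f ssum j.+1 (fun s => kap (f :: s) *: herm m (f :: s)))).
rewrite linear_sum (eq_bigr _ (fun f _ => E f)).
have split_sum (Q P : T -> A) c : \sum_f ((e == f)%:R * Q f + c *: P f) =
    c *: (\sum_f P f) + Q e.
  rewrite big_split /= -scaler_sumr (bigD1 e) //= eqxx mul1r big1 => [|f fe].
    by rewrite addr0 addrC.
  by rewrite eq_sym (negPf fe) mul0r.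
rewrite (split_sum (fun f => ssum j.+1 (fun s => kap (f :: s) *: herm m s))).
by rewrite -[in RHS]natr1 scalerDl scale1r.
Qed.

(** All orderings of a multiset are summed. With the factor [1 / j!] the multiset receives the
    coefficient [kap / alpha!], where [alpha!], the product of the factorials of its multiplicities,
    is the squared norm of its Hermite polynomial. *)
Definition dual kap (J : nat) : A :=
  \sum_(j < J.+1) j`!%:R^-1 *: ssum j (fun s => kap s *: herm (fun _ => 0) s).

Lemma d_dualS e kap J : perm_invariant kap ->
  d e (dual kap J.+1) = dual (fun s => kap (e :: s)) J.
Proof.
move=> kapP; rewrite /dual linear_sum big_ord_recl /= !linearZ /= d1 !scaler0 add0r.
apply: eq_bigr => j _; rewrite linearZ /=.
rewrite -[\sum_e0 _]/(ssum (bump 0 j) (fun s => kap s *: herm (fun _ => 0) s)).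
rewrite d_ssum_herm // scalerA; congr (_ *: _).
by rewrite /bump leq0n add1n factS natrM invfM mulrAC mulVf ?mul1r // pnatr_eq0.
Qed.

(** [L] stands for the expectation under the standard Gaussian law. The duality needs it only as a
    normalised positive linear form satisfying Stein's identity. *)
Variable L : A -> R.
Hypothesis L_linear : forall a p q, L (a *: p + q) = a * L p + L q.
Hypothesis L1 : L 1 = 1.
Hypothesis L_stein : forall e q, L (X e * q) = L (d e q).

Let L0 : L 0 = 0.
Proof. by have := L_linear (-1) 0 0; rewrite scaler0 addr0 mulN1r addNr. Qed.
Let LD p q : L (p + q) = L p + L q.
Proof. by have := L_linear 1 p q; rewrite scale1r mul1r. Qed.
Let LZ a p : L (a *: p) = a * L p.
Proof. by have := L_linear a p 0; rewrite L0 !addr0. Qed.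
Let LB p q : L (p - q) = L p - L q.
Proof. by rewrite addrC -scaleN1r L_linear mulN1r addrC. Qed.
Let Lsum (I : Type) (r : seq I) (P : pred I) (F : I -> A) :
  L (\sum_(i <- r | P i) F i) = \sum_(i <- r | P i) L (F i).
Proof. exact: (big_morph L LD L0). Qed.
Let Lssum j (F : seq T -> A) : L (ssum j F) = ssum j (fun s => L (F s)).
Proof.
by elim: j F => //= j IH F; rewrite Lsum; apply: eq_bigr => e _; rewrite IH.
Qed.

(** Integration by parts: [X e - d e] is adjoint to [d e], so the letter [e] either leaves its mean
    [m e] or differentiates [h]. *)
Lemma L_hermM m e u h :
  L (herm m (e :: u) * h) = m e * L (herm m u * h) + L (herm m u * d e h).
Proof.
rewrite /= mulrBl mulrDl mulrDl LB LD -!mulrA L_stein dM LD -scalerAl mul1r LZ.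
by ring.
Qed.

Lemma L_herm m u : L (herm m u) = mono m u.
Proof.
elim: u => [|e u IH]; first by rewrite L1 /mono big_nil.
by rewrite -[LHS]mulr1 -[L _ * 1]mulr1 -[herm m _]mulr1 !mulr1
  -[herm m (e :: u)]mulr1 L_hermM d1 mulr0 L0 addr0 mulr1 IH /mono big_cons.
Qed.

Lemma L_dual kap J : L (dual kap J) = kap [::].
Proof.
rewrite /dual Lsum big_ord_recl [X in X + _ = _]/= fact0 invr1 scale1r LZ L1 mulr1.
rewrite big1 ?addr0 // => j _; rewrite lift0 LZ Lssum.
rewrite (@eq_ssum _ _ _ _ (fun _ => 0 * 0)) ?ssumZ ?mul0r ?mulr0 // => -[//|e s] _.
by rewrite LZ L_herm /mono big_cons !mul0r mulr0.
Qed.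

(** Each letter of [u] goes to [b] as a factor, or to [a] as a derivative of the dual polynomial,
    which by [d_dualS] prefixes the letter to the index of [kap]. Since [size u <= J], the
    truncation is never felt. *)
Lemma L_herm_dual m kap u J : perm_invariant kap -> (size u <= J)%N ->
  L (herm m u * dual kap J) = usum (fun a b => kap a * mono m b) u.
Proof.
elim: u J kap => [|e u IH] J kap kapP.
  by move=> _; rewrite mul1r L_dual /= /mono big_nil mulr1.
case: J => // J; rewrite ltnS => uJ; rewrite L_hermM d_dualS // IH //; last exact: leqW.
rewrite IH //; last exact: perm_invariant_cons.
rewrite addrC /= -usumZ; congr (_ + _); apply: eq_usum => a b _.
by rewrite /mono big_cons mulrCA.
Qed.

(** Parseval's identity: for the zero shift, only the split with empty [b] survives in
    [L_herm_dual]. *)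
Lemma L_dual_sqr kap J : perm_invariant kap ->
  L (dual kap J * dual kap J) = \sum_(j < J.+1) j`!%:R^-1 * ssum j (fun s => kap s ^+ 2).
Proof.
move=> kapP; rewrite {1}/dual mulr_suml Lsum; apply: eq_bigr => j _.
rewrite -scalerAl LZ (@ssum_morph _ _ _ (fun p => p * dual kap J)) ?mul0r //; last first.
  by move=> p q; rewrite mulrDl.
rewrite Lssum; congr (_ * _); apply: eq_ssum => s sj.
rewrite -scalerAl LZ L_herm_dual //; last by rewrite sj -ltnS.
rewrite usum_nilp /mono big_nil mulr1 (@eq_usum _ _ _ (fun _ _ => 0)).
  by rewrite usum0 addr0.
move=> a [|e b] _ //=; by rewrite big_cons mul0r mulr0.
Qed.

Hypothesis L_sqr_ge0 : forall p, 0 <= L (p * p).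

(* The polynomial [dual kappa D] of the noise satisfies
   [E[f(Y) dual(Z)] = E[f(Y) x]] for every [f] of degree at most [D]. *)
Lemma low_degree_duality (S : finType) (w : S -> R) (m : S -> T -> R) (x : T) (D : nat)
    (c : seq (R * seq T)) :
  (forall i, 0 <= w i) -> \sum_i w i = 1 -> all (fun cu => size cu.2 <= D)%N c ->
  let mu s := \sum_i w i * mono (m i) s in
  let F i := \sum_(cu <- c) cu.1 *: herm (m i) cu.2 in
  let kap := cumulant mu (fun s => mu (x :: s)) in
  (\sum_i w i * m i x ^+ 2 - \sum_(j < D.+1) j`!%:R^-1 * ssum j (fun s => kap s ^+ 2) <=
  \sum_i w i * L ((F i - m i x *: 1) * (F i - m i x *: 1)) : Prop).
Proof.
move=> w0 w1 cD mu F kap; have muP : perm_invariant mu.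
  move=> s t st; apply: eq_bigr => i _; congr (_ * _); exact: perm_big.
have kapP : perm_invariant kap.
  by apply: perm_cumulant => //; apply: perm_invariant_cons.
have mu1 : mu [::] = 1 by rewrite /mu -[RHS]w1; apply: eq_bigr => i _; rewrite /mono big_nil mulr1.
rewrite -L_dual_sqr //; set g := dual kap D.
(* Positivity of [L] at [F i - g] bounds [L (F i * F i)] below by [2 * L (F i * g) - L (g * g)]. The
   terms linear in [F i] cancel only after averaging over [i]. *)
have le_i i : w i * (2 * L (F i * g) - L (g * g) - 2 * m i x * L (F i) + m i x ^+ 2) <=
    w i * L ((F i - m i x *: 1) * (F i - m i x *: 1)).
  apply: ler_wpM2l => //; have := L_sqr_ge0 (F i - g).
  rewrite !mulrBl !mulrBr !LB -!scalerAl -!scalerAr !mulr1 !mul1r !LZ L1.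
  rewrite [L (g * F i)](_ : _ = L (F i * g)) 1?[g * _]mulrC //.
  move: (L (F i * F i)) (L (F i * g)) (L (g * g)) (L (F i)) => a b e f; nra.
apply: le_trans (ler_sum _ (fun i _ => le_i i)).
(* The dual constraint. The coefficients [c] are common to all [i], so averaging acts on the
   monomials alone and turns the split sums into those of [usum_cumulant]. *)
have orth : \sum_i w i * L (F i * g) = \sum_i w i * (m i x * L (F i)).
  transitivity (\sum_(cu <- c) cu.1 * mu (x :: cu.2)).
    have E i : w i * L (F i * g) =
        \sum_(cu <- c) cu.1 * (w i * usum (fun a b => kap a * mono (m i) b) cu.2).
      rewrite /F mulr_suml Lsum mulr_sumr big_seq [RHS]big_seq; apply: eq_bigr => cu cuc.
      rewrite -scalerAl LZ L_herm_dual //; first by ring.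
      exact: (allP cD).
    rewrite (eq_bigr _ (fun i _ => E i)) exchange_big /=; apply: eq_bigr => cu _.
    rewrite -mulr_sumr; congr (_ * _).
    rewrite -[mu (x :: cu.2)](usum_cumulant (fun s => mu (x :: s)) cu.2 mu1) -/kap.
    under eq_bigr do rewrite -usumZ.
    rewrite -usum_sum; apply: eq_usum => a b _; rewrite /mu mulr_sumr.
    by apply: eq_bigr => i _; rewrite mulrCA.
  rewrite [RHS](eq_bigr (fun i => \sum_(cu <- c) cu.1 * (w i * mono (m i) (x :: cu.2)))).
    by rewrite exchange_big /=; apply: eq_bigr => cu _; rewrite mulr_sumr.
  move=> i _; rewrite /F Lsum !mulr_sumr; apply: eq_bigr => cu _.
  by rewrite LZ L_herm /mono big_cons; ring.
rewrite le_eqVlt; apply/orP; left; apply/eqP.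
move: (L (g * g)) => G; have {1}-> : G = \sum_i w i * G by rewrite -mulr_suml w1 mul1r.
transitivity (\sum_i w i * m i x ^+ 2 - \sum_i w i * G +
  2 * (\sum_i w i * L (F i * g) - \sum_i w i * (m i x * L (F i)))).
  by rewrite orth subrr mulr0 addr0.
rewrite -[X in X + _]sumrB -sumrB mulr_sumr -big_split /=; apply: eq_bigr => i _; ring.
Qed.

End Hermite.

(** * Polynomials in the shifted variable as combinations of Hermite polynomials *)

Section PolynomialSpan.
Variables (R : realFieldType) (N : nat) (T : finType) (idx : T -> 'I_N) (lab : 'I_N -> T).
Hypotheses (idxK : cancel idx lab) (labK : cancel lab idx).

Local Notation poly := (mpoly N R).

Definition pvar (e : T) : poly := mpolyX R (mnm1 (idx e)).
Definition pderiv (e : T) : {linear poly -> poly} := mderiv (idx e).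

Lemma pderivM e (p q : poly) : pderiv e (p * q) = pderiv e p * q + p * pderiv e q.
Proof. exact: mderivM. Qed.

Lemma pderivX e f : pderiv e (pvar f) = (e == f)%:R.
Proof.
rewrite /pderiv /pvar /= mderivX mnm1E (inj_eq (can_inj idxK)) eq_sym.
case: eqVneq => [->|_]; last by rewrite scale0r.
rewrite scale1r (_ : mnm_sub _ _ = mnm0) ?mpolyX0 //.
by apply/mnmP => i; rewrite mnmBE subnn mnm0E.
Qed.

Lemma pderivC e f (p : poly) : pderiv e (pderiv f p) = pderiv f (pderiv e p).
Proof. exact: mderiv_comm. Qed.

Local Notation hermp := (herm pvar pderiv).

(** The combination [c] is chosen before the shift [m]: a single list must serve every value of the
    signal, as [low_degree_duality] requires. *)
Definition in_span (n : nat) (F : (T -> R) -> ('I_N -> R) -> R) :=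
  exists2 c : seq (R * seq T), all (fun cu => size cu.2 <= n)%N c &
    forall m z, F m z = meval z (\sum_(cu <- c) cu.1 *: hermp m cu.2).

Lemma in_span_sum n (I : eqType) (r : seq I) F :
  {in r, forall i, in_span n (F i)} -> in_span n (fun m z => \sum_(i <- r) F i m z).
Proof.
elim: r => [|i r IH] sF; first by exists [::] => // m z; rewrite !big_nil meval0.
have [c1 c1n c1E] := sF i (mem_head _ _).
have [|c2 c2n c2E] := IH; first by move=> j jr; apply: sF; rewrite inE jr orbT.
exists (c1 ++ c2); first by rewrite all_cat c1n.
by move=> m z; rewrite big_cons big_cat mevalD c1E c2E.
Qed.

Lemma in_spanZ n a F : in_span n F -> in_span n (fun m z => a * F m z).
Proof.
move=> [c cn cE]; exists [seq (a * cu.1, cu.2) | cu <- c]; first by rewrite all_map.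
move=> m z; rewrite cE -mevalZ big_map scaler_sumr; congr (meval _ _).
by apply: eq_bigr => cu _; rewrite scalerA.
Qed.

(** The recursion of [herm] read backwards: multiplying by [X e + m e] yields the Hermite polynomial
    of [e :: u] plus a derivative, which [dherm] expands. *)
Lemma in_spanM e n F : in_span n F -> in_span n.+1 (fun m z => (m e + z (idx e)) * F m z).
Proof.
move=> [c cn cE].
exists (flatten [seq (cu.1, e :: cu.2) ::
    [seq (cu.1 * dv.1, dv.2) | dv <- dherm R e cu.2] | cu <- c]).
  apply/allP => v /flattenP[_ /mapP[cu cuc ->]]; have /= cun := allP cn _ cuc.
  rewrite inE => /predU1P[-> //=|/mapP[dv dve ->] /=].
  have /eqP dvs := allP (size_dherm R e cu.2) _ dve.
  by apply: leqW; apply: leq_trans cun; rewrite -dvs.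
move=> m z; rewrite cE.
have -> : m e + z (idx e) = meval z (pvar e + m e *: 1).
  by rewrite mevalD mevalZ meval1 mulr1 /pvar mevalXU addrC.
rewrite -mevalM big_flatten big_map mulr_sumr; congr (meval _ _).
apply: eq_bigr => cu _; rewrite big_cons big_map /=.
under [X in _ = _ + X]eq_bigr do rewrite -scalerA.
rewrite -scaler_sumr -(dhermE pderivM pderivX pderivC) -scalerDr subrK.
by rewrite -scalerAr.
Qed.

Lemma in_span_mono (mo : multinom N) :
  in_span (mdeg mo) (fun m z => meval (fun i => m (lab i) + z i) (mpolyX R mo)).
Proof.
have [n] := ubnP (mdeg mo); elim: n mo => // n IH mo mon.
have [/eqP|mo0] := posnP (mdeg mo).
  rewrite mdeg_eq0 => /eqP ->; exists [:: (1, [::])] => //.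
  by move=> m z; rewrite big_seq1 /= scale1r mpolyX0 !meval1.
have [i moi] : exists i, mo i != 0%N.
  apply/existsP; rewrite -negb_forall; apply: contraTN mo0 => /forallP mo0.
  by rewrite mdegE big1 // => i _; exact/eqP.
have := submK (etrans (lep1mP i mo) moi); set mo' := mnm_sub _ _ => moE.
have deg : mdeg mo = (mdeg mo').+1 by rewrite -moE mdegD mdeg1 addn1.
have mo'n : (mdeg mo' < n)%N by rewrite -ltnS -deg.
have [c cn cE] := in_spanM (lab i) (IH mo' mo'n).
rewrite deg; exists c => // m z; rewrite -cE -moE mpolyXD mevalM mevalXU labK mulrC.
by [].
Qed.

Lemma in_span_mpoly D (f : poly) : (msize f <= D.+1)%N ->
  in_span D (fun m z => meval (fun i => m (lab i) + z i) f).
Proof.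
move=> fD.
have E m z : meval (fun i => m (lab i) + z i) f =
    \sum_(mo <- msupp f) mcoeff mo f * meval (fun i => m (lab i) + z i) (mpolyX R mo).
  by rewrite {1}[f]mpolyE raddf_sum /=; apply: eq_bigr => mo _; rewrite mevalZ.
have [c cD cE] : in_span D (fun m z => \sum_(mo <- msupp f) mcoeff mo f *
    meval (fun i => m (lab i) + z i) (mpolyX R mo)).
  apply: in_span_sum => mo mof; apply: in_spanZ.
  have [c cn cE] := in_span_mono mo; exists c => //.
  apply: sub_all cn => cu /leq_trans; apply.
  by rewrite -ltnS; apply: leq_trans (msize_mdeg_lt mof) fD.
by exists c => // m z; rewrite E cE.
Qed.

End PolynomialSpan.

(** * The signal as a finite mixture over agreement patterns *)

Section Pattern.
Variables (R : realFieldType) (I J : finType) (k : nat) (lambda : R).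

Local Notation labelling := {ffun I + J -> 'I_k.+1}.
Local Notation pattern := {ffun I * J -> bool}.

(** Patterns rather than labellings index the mixture because the noise is assumed independent of
    [M], and [M] reveals the agreements but not the labels. *)
Definition pattern_of (z : labelling) : pattern := [ffun e => agree z e].

Definition pattern_weight (S : pattern) : R :=
  #|[set z | pattern_of z == S]|%:R / #|{: labelling}|%:R.

Definition pattern_signal (S : pattern) (e : I * J) : R := lambda * (S e)%:R.

(** The difference of the two end labels is equidistributed: its fibers are translates of the
    agreeing subgroup by labellings supported at [inl x.1]. *)
Lemma agree_prob_edge (x : I * J) : agree_prob R k [:: x] = k.+1%:R^-1 :> R.
Proof.
pose diff (z : labelling) : 'I_k.+1 := z (inl x.1) - z (inr x.2).
pose bump (c : 'I_k.+1) : labelling := [ffun v => if v == inl x.1 then c else 0].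
have fiberE c : [set z | diff z == c] = (fun z : labelling => z + bump c) @: agree_set k [:: x].
  apply/setP => z; rewrite inE; apply/eqP/imsetP => [zc|[u]].
    exists (z - bump c); last by rewrite subrK.
    by rewrite inE /= andbT /agree !ffunE eqxx /= subr0 -zc /diff opprB addrC subrK.
  rewrite inE /= andbT /agree => /eqP ux ->.
  by rewrite /diff !ffunE eqxx /= addr0 ux addrC addKr.
have card_fiber_c c : #|[set z | diff z == c]| = #|agree_set k [:: x]|.
  by rewrite fiberE card_imset //; exact: addIr.
have : (#|{: labelling}| = k.+1 * #|agree_set k [:: x]|)%N.
  rewrite -[LHS]sum1_card (partition_big diff xpredT) //=.
  rewrite (eq_bigr (fun _ => #|agree_set k [:: x]|)) ?sum_nat_const ?card_ord // => c _.
  by rewrite -(card_fiber_c c) -sum1_card; apply: eq_bigl => z; rewrite inE.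
move=> cardL; have := card_labelling_gt0 R I J k.
rewrite /agree_prob cardL natrM pmulr_rgt0 ?ltr0n // => H0.
by rewrite invfM mulrCA divff ?mulr1 // gt_eqF ?ltr0n.
Qed.

Lemma pattern_weight_ge0 S : 0 <= pattern_weight S.
Proof. by rewrite divr_ge0. Qed.

Lemma sum_pattern_weight (g : pattern -> R) :
  \sum_S pattern_weight S * g S = \sum_(z : labelling) g (pattern_of z) / #|{: labelling}|%:R.
Proof.
rewrite [RHS](partition_big pattern_of xpredT) //=; apply: eq_bigr => S _.
rewrite (eq_bigr (fun _ => g S / #|{: labelling}|%:R)) => [|z /eqP -> //].
rewrite sumr_const -[RHS]mulr_natl /pattern_weight -mulrA [_^-1 * _]mulrC.
by congr (_%:R * _); apply: eq_card => z; rewrite inE.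
Qed.

Lemma sum_pattern_weight1 : \sum_S pattern_weight S = 1.
Proof.
transitivity (\sum_S pattern_weight S * 1); first by apply: eq_bigr => S _; rewrite mulr1.
rewrite sum_pattern_weight sumr_const -[_ *+ _]mulr_natl mulrA mulr1 divff //.
by rewrite gt_eqF // card_labelling_gt0.
Qed.

Lemma mono_pattern S (s : seq (I * J)) : mono (pattern_signal S) s = lambda ^+ size s * (all S s)%:R.
Proof.
elim: s => [|e s IH]; first by rewrite /mono big_nil mul1r.
rewrite /mono big_cons -/(mono _ _) IH /= exprS -mulnb natrM /pattern_signal.
by rewrite mulrACA.
Qed.

Lemma pattern_moment (s : seq (I * J)) :
  \sum_S pattern_weight S * mono (pattern_signal S) s = lambda ^+ size s * agree_prob R k s.
Proof.
rewrite sum_pattern_weight -mulr_suml /agree_prob mulrA; congr (_ / _).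
rewrite -sum1_card natr_sum mulr_sumr [RHS]big_mkcond; apply: eq_bigr => z _.
rewrite mono_pattern inE (@eq_all _ _ (agree z)) => [|e]; last by rewrite ffunE.
by case: (all _ _); rewrite ?mulr0.
Qed.

Lemma pattern_signal_sqr (x : I * J) :
  \sum_S pattern_weight S * pattern_signal S x ^+ 2 = lambda ^+ 2 / k.+1%:R.
Proof.
rewrite -(agree_prob_edge x); have := pattern_moment [:: x; x].
rewrite (@eq_mem_agree_prob _ _ _ _ _ [:: x]) => [<-|e]; last by rewrite !inE orbb.
by apply: eq_bigr => S _; rewrite /mono !big_cons big_nil mulr1.
Qed.

End Pattern.

(** * Gaussian moments *)

(* Imported only here: these libraries shadow names of fintype and finset. *)
From mathcomp Require Import all_classical all_reals all_analysis measurable_realfun.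
Import numFieldNormedType.Exports.

(** * From indicators to integrable functions, under a weight *)

Section DensityTransfer.
Local Open Scope classical_set_scope.
Import HBNNSimple.
Context d d' (T : measurableType d) (T' : measurableType d') (R : realType).
Variables (mu : {measure set T -> \bar R}) (nu : {measure set T' -> \bar R}).
Variables (W : T -> R) (X : T -> T') (c : R).
Hypotheses (mW : measurable_fun setT W) (W0 : forall x, 0 <= W x).
Hypothesis mX : measurable_fun setT X.
Hypothesis WX : forall B, measurable B ->
  (\int[mu]_x (W x * \1_(X @^-1` B) x)%:E = c%:E * nu B)%E.

Let density_nnsfun (h : {nnsfun T' >-> R}) :
  (\int[mu]_x (W x * h (X x))%:E = c%:E * \int[nu]_y (h y)%:E)%E.
Proof.
have mh r : measurable (X @^-1` (h @^-1` [set r])) by rewrite -[_ @^-1` _]setTI; exact: mX.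
rewrite integralT_nnsfun sintegralE ge0_mule_fsumr; last first.
  by move=> r; exact: nnsfun_mulemu_ge0.
transitivity (\int[mu]_x (\sum_(r \in range h) (r * (W x * \1_(X @^-1` (h @^-1` [set r])) x))%:E)%E)%E.
  apply: eq_integral => x _; rewrite fsumEFin //; congr EFin.
  rewrite {1}[h (X x)]fimfunE !fsbig_finite //= mulr_sumr.
  by apply: eq_bigr => r _; rewrite mulrCA.
rewrite ge0_integral_fsum //=; last 2 first.
- move=> r; apply/measurable_EFinP; apply: measurable_funM => //; apply: measurable_funM => //.
- move=> r x _; rewrite lee_fin mulrCA mulr_ge0 // indicE.
  by case: (boolP (x \in _)) => [|_]; rewrite ?mulr0 // inE /= => <-; rewrite mulr1.
apply: eq_fsbigr => r; rewrite inE => -[y _ <-].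
rewrite muleCA -WX // -ge0_integralZl //.
- apply/measurable_EFinP; apply: measurable_funM => //.
- by move=> x _; rewrite lee_fin mulr_ge0.
- by rewrite lee_fin.
Qed.

(** Simple functions, then monotone convergence. Behind it are two situations: [W] a density with
    [X] the identity, and [W] a product of factors independent of [X]. *)
Lemma ge0_integral_density (f : T' -> R) :
  measurable_fun setT f -> (forall y, 0 <= f y) ->
  (\int[mu]_x (W x * f (X x))%:E = c%:E * \int[nu]_y (f y)%:E)%E.
Proof.
move=> mf f0; have mEf : measurable_fun setT (EFin \o f) by exact/measurable_EFinP.
pose h := nnsfun_approx measurableT mEf.
have hf y : (h n y)%:E @[n --> \oo] --> (f y)%:E.
  by apply: cvg_nnsfun_approx => // ? _; rewrite lee_fin.
have hnd y : {homo (fun n => h n y) : m n / (m <= n)%N >-> m <= n}.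
  by move=> m n mn; exact/lefP/nd_nnsfun_approx.
have cvgR : (c%:E * \int[nu]_y (h n y)%:E)%E @[n --> \oo] --> (c%:E * \int[nu]_y (f y)%:E)%E.
  apply: cvgeZl => //.
  rewrite [X in _ --> X](_ : _ = \int[nu]_y limn (fun n => (h n y)%:E))%E; last first.
    by apply: eq_integral => y _; apply/esym/cvg_lim => //; exact: hf.
  apply: cvg_monotone_convergence => //.
  - by move=> n; exact/measurable_EFinP.
  - by move=> n x _; rewrite lee_fin.
  - by move=> x _ m n mn; rewrite lee_fin hnd.
have cvgL : (\int[mu]_x (W x * h n (X x))%:E)%E @[n --> \oo] --> (\int[mu]_x (W x * f (X x))%:E)%E.
  rewrite [X in _ --> X](_ : _ = \int[mu]_x limn (fun n => (W x * h n (X x))%:E))%E; last first.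
    apply: eq_integral => x _; apply/esym/cvg_lim => //.
    under eq_fun do rewrite EFinM.
    by rewrite EFinM; apply: cvgeZl => //; exact: hf.
  apply: cvg_monotone_convergence => //.
  - by move=> n; apply/measurable_EFinP/measurable_funM => //; exact: measurableT_comp.
  - by move=> n x _; rewrite lee_fin mulr_ge0.
  - by move=> x _ m n mn; rewrite lee_fin ler_wpM2l // hnd.
have E : (fun n => c%:E * \int[nu]_y (h n y)%:E)%E = (fun n => \int[mu]_x (W x * h n (X x))%:E)%E.
  by apply/funext => n; rewrite density_nnsfun.
rewrite E in cvgR; exact: cvg_unique cvgL cvgR.
Qed.

End DensityTransfer.

Section RealIntegrable.
Context d (T : measurableType d) (R : realType) (mu : {measure set T -> \bar R}).
Implicit Types f g : T -> R.

Definition intble f := mu.-integrable setT (EFin \o f).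
Definition rint f : R := \int[mu]_x f x.

Lemma eq_intble f g : f =1 g -> intble f -> intble g.
Proof. by move=> /funext ->. Qed.

Lemma eq_rint f g : f =1 g -> rint f = rint g.
Proof. by move=> /funext ->. Qed.

Lemma intbleD f g : intble f -> intble g -> intble (fun x => f x + g x).
Proof. by move=> f_ g_; apply: (integrableD measurableT f_ g_). Qed.

Lemma intbleZ a f : intble f -> intble (fun x => a * f x).
Proof. by move=> f_; apply: (integrableZl measurableT a f_). Qed.

Lemma intbleB f g : intble f -> intble g -> intble (fun x => f x - g x).
Proof. by move=> f_ g_; apply: (integrableB measurableT f_ g_). Qed.

Lemma intble_norm f : intble f -> intble (fun x => `|f x|).
Proof. exact: integrable_norm. Qed.

Lemma rintD f g : intble f -> intble g -> rint (fun x => f x + g x) = rint f + rint g.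
Proof. by move=> f_ g_; apply: RintegralD. Qed.

Lemma rintB f g : intble f -> intble g -> rint (fun x => f x - g x) = rint f - rint g.
Proof. by move=> f_ g_; apply: RintegralB. Qed.

Lemma rintZ a f : intble f -> rint (fun x => a * f x) = a * rint f.
Proof. by move=> f_; apply: RintegralZl. Qed.

Lemma intble_measurable f : intble f -> measurable_fun setT f.
Proof. by move=> /measurable_int /measurable_EFinP. Qed.

Lemma EFin_rint f : intble f -> (\int[mu]_x (f x)%:E = (rint f)%:E)%E.
Proof. by move=> f_; rewrite fineK //; apply: integrable_fin_num. Qed.

Lemma rint_ge0 f : (forall x, 0 <= f x) -> 0 <= rint f.
Proof. by move=> f0; apply: Rintegral_ge0. Qed.

Lemma intble_mul_indic f A : measurable A -> intble f -> intble (fun x => f x * \1_A x).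
Proof.
move=> mA f_; apply: (le_integrable measurableT _ _ f_).
  apply/measurable_EFinP; apply: measurable_funM => //.
  exact: intble_measurable.
move=> x _; rewrite lee_fin normrM indicE ler_piMr //.
by case: (_ \in _); rewrite ?normr1 // normr0.
Qed.

Lemma intble_ge0 f : measurable_fun setT f -> (forall x, 0 <= f x) ->
  (\int[mu]_x (f x)%:E < +oo)%E -> intble f.
Proof.
move=> mf f0 fy; apply/integrableP; split; first exact/measurable_EFinP.
by under eq_integral do rewrite /= ger0_norm //.
Qed.

End RealIntegrable.

Section DensityTransferSigned.
Local Open Scope classical_set_scope.
Context d d' (T : measurableType d) (T' : measurableType d') (R : realType).
Variables (mu : {measure set T -> \bar R}) (nu : probability T' R).
Variables (X : T -> T') (mX : measurable_fun setT X).

Let density_ge0 (W : T -> R) (c : R) (f : T' -> R) :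
  intble mu W -> (forall x, 0 <= W x) ->
  (forall B, measurable B -> rint mu (fun x => W x * \1_(X @^-1` B) x) = c * fine (nu B)) ->
  intble nu f -> (forall x, 0 <= f x) ->
  intble mu (fun x => W x * f (X x)) /\ rint mu (fun x => W x * f (X x)) = c * rint nu f.
Proof.
move=> W_ W0 WX f_ f0; have mf := intble_measurable f_; have mW := intble_measurable W_.
have c0 : 0 <= c.
  have := WX _ measurableT; rewrite probability_setT mulr1 => <-.
  by apply: rint_ge0 => x; rewrite mulr_ge0.
have E : (\int[mu]_x (W x * f (X x))%:E = c%:E * \int[nu]_y (f y)%:E)%E.
  apply: ge0_integral_density => // B mB.
  rewrite EFin_rint ?WX // ?EFinM ?fineK //; first exact: fin_num_measure.
  by apply: intble_mul_indic => //; rewrite -[_ @^-1` _]setTI; exact: mX.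
rewrite (EFin_rint f_) -EFinM in E.
split; last by rewrite /rint /Rintegral E.
apply: intble_ge0 => [|x|].
- by apply: measurable_funM => //; exact: measurableT_comp.
- by rewrite mulr_ge0.
- by rewrite E ltry.
Qed.

Let density_signed_fun (W : T -> R) (c : R) (f : T' -> R) :
  intble mu W -> (forall x, 0 <= W x) ->
  (forall B, measurable B -> rint mu (fun x => W x * \1_(X @^-1` B) x) = c * fine (nu B)) ->
  intble nu f ->
  intble mu (fun x => W x * f (X x)) /\ rint mu (fun x => W x * f (X x)) = c * rint nu f.
Proof.
move=> W_ W0 WX f_; have nf_ := intble_norm f_.
pose fp y := 2^-1 * (`|f y| + f y); pose fn y := 2^-1 * (`|f y| - f y).
have fp_ : intble nu fp by apply/intbleZ/intbleD.
have fn_ : intble nu fn by apply/intbleZ/intbleB.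
have fE y : f y = fp y - fn y by rewrite /fp /fn; lra.
have [pI pE] : intble mu (fun x => W x * fp (X x)) /\
    rint mu (fun x => W x * fp (X x)) = c * rint nu fp.
  apply: density_ge0 => // y; rewrite mulr_ge0 //.
  by have := ler_norm (- f y); rewrite normrN; lra.
have [nI nE] : intble mu (fun x => W x * fn (X x)) /\
    rint mu (fun x => W x * fn (X x)) = c * rint nu fn.
  by apply: density_ge0 => // y; rewrite mulr_ge0 // subr_ge0 ler_norm.
have WfE x : W x * fp (X x) - W x * fn (X x) = W x * f (X x) by rewrite fE mulrBr.
split; first by apply: (eq_intble WfE); apply: intbleB.
by rewrite -(eq_rint _ WfE) rintB // pE nE (eq_rint _ fE) rintB // mulrBr.
Qed.

(** The hypothesis on the absolute value of [W] passes the identity to its positive and negative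
    parts, where the nonnegative case applies. *)
Lemma integral_density (W : T -> R) (c c' : R) (f : T' -> R) :
  intble mu W ->
  (forall B, measurable B -> rint mu (fun x => W x * \1_(X @^-1` B) x) = c * fine (nu B)) ->
  (forall B, measurable B -> rint mu (fun x => `|W x| * \1_(X @^-1` B) x) = c' * fine (nu B)) ->
  intble nu f ->
  intble mu (fun x => W x * f (X x)) /\ rint mu (fun x => W x * f (X x)) = c * rint nu f.
Proof.
move=> W_ WX nWX f_; have nW_ := intble_norm W_.
have mXB B : measurable B -> measurable (X @^-1` B).
  by move=> mB; rewrite -[_ @^-1` _]setTI; exact: mX.
pose Wp x := 2^-1 * (`|W x| + W x); pose Wn x := 2^-1 * (`|W x| - W x).
have [pI pE] : intble mu (fun x => Wp x * f (X x)) /\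
    rint mu (fun x => Wp x * f (X x)) = (2^-1 * (c' + c)) * rint nu f.
  apply: density_signed_fun => // [|x|B mB].
  - by apply/intbleZ/intbleD.
  - by rewrite mulr_ge0 //; have := ler_norm (- W x); rewrite normrN; lra.
  rewrite (@eq_rint _ _ _ _ _ (fun x => 2^-1 * (`|W x| * \1_(X @^-1` B) x + W x * \1_(X @^-1` B) x))).
    rewrite rintZ ?rintD ?WX ?nWX //; [by ring|..]; try apply: intbleD; by apply: intble_mul_indic; auto.
  by move=> x; rewrite -mulrA mulrDl.
have [nI nE] : intble mu (fun x => Wn x * f (X x)) /\
    rint mu (fun x => Wn x * f (X x)) = (2^-1 * (c' - c)) * rint nu f.
  apply: density_signed_fun => // [|x|B mB].
  - by apply/intbleZ/intbleB.
  - by rewrite mulr_ge0 // subr_ge0 ler_norm.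
  rewrite (@eq_rint _ _ _ _ _ (fun x => 2^-1 * (`|W x| * \1_(X @^-1` B) x - W x * \1_(X @^-1` B) x))).
    rewrite rintZ ?rintB ?WX ?nWX //; [by ring|..]; try apply: intbleB; by apply: intble_mul_indic; auto.
  by move=> x; rewrite -mulrA mulrBl.
have WfE x : Wp x * f (X x) - Wn x * f (X x) = W x * f (X x) by rewrite /Wp /Wn; lra.
split; first by apply: (eq_intble WfE); apply: intbleB.
by rewrite -(eq_rint _ WfE) rintB // pE nE; lra.
Qed.

End DensityTransferSigned.

Section GaussianMoments.
Local Open Scope classical_set_scope.
Variable R : realType.
Local Notation leb := (@lebesgue_measure R).
Local Notation pdf := (normal_pdf (0 : R) 1).

Lemma std_normal_pdfE (x : R) : pdf x = normal_peak (1 : R) * expR (- (x ^+ 2 / 2)).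
Proof. by rewrite normal_pdfE ?oner_eq0 // /normal_fun subr0 expr1n mulNr. Qed.

Lemma normal_pdf_dominates j : {C : R | 0 < C &
  forall x, `|x ^+ j| * pdf x <= C * normal_pdf 0 2 x}.
Proof.
pose K : R := 1 + (8 / 3) ^+ j.+1 * j.+1`!%:R.
have K0 : 0 < K by rewrite ltr_pwDl // mulr_ge0 ?exprn_ge0 //; lra.
have p1 : 0 < normal_peak (1 : R) by exact: normal_peak_gt0.
have p2 : 0 < normal_peak (2 : R) by exact: normal_peak_gt0.
exists (normal_peak 1 * K / normal_peak 2); first by rewrite divr_gt0 // mulr_gt0.
move=> x; rewrite std_normal_pdfE normal_pdfE // [leRHS]mulrA divfK ?gt_eqF //.
rewrite mulrCA -[leRHS]mulrA ler_pM2l // /normal_fun subr0.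
(* [3 / 8] is the gap between the Gaussian exponents [1 / 2] and [1 / 8] for standard deviations 1
   and 2. It remains to bound a power of [x] by [expR t], through one term of the exponential
   series. *)
pose t := 3 / 8 * x ^+ 2; have t0 : 0 <= t by rewrite mulr_ge0 ?sqr_ge0 //; lra.
have xt : `|x ^+ j| <= K * expR t.
  apply: (@le_trans _ _ (1 + (8 / 3 * t) ^+ j.+1)).
    rewrite /t mulrA (_ : 8 / 3 * (3 / 8) = 1) ?mul1r; last by field.
    rewrite normrX -[x ^+ 2]real_normK ?num_real //.
    have [x1|x1] := leP `|x| 1.
      apply: (@le_trans _ _ 1); first exact: exprn_ile1.
      by rewrite lerDl exprn_ge0 // sqr_ge0.
    rewrite -[leLHS]add0r lerD // -exprM; apply: ler_weXn2l; [exact: ltW|lia].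
  have := expR_ge1Dxn j t0; have f0 : 0 < j.+1`!%:R :> R by rewrite ltr0n fact_gt0.
  have E0 : 1 <= expR t by rewrite -expR0 ler_expR.
  have -> : K * expR t = expR t + (8 / 3) ^+ j.+1 * (j.+1`!%:R * expR t) by rewrite /K; ring.
  move=> le1; rewrite exprMn; apply: lerD => //.
  apply: ler_wpM2l; first by apply: exprn_ge0; lra.
  rewrite -ler_pdivrMl // mulrC; apply: le_trans le1; by rewrite lerDr.
apply: le_trans (ler_wpM2r (expR_ge0 _) xt) _.
rewrite -mulrA ler_pM2l // -expRD ler_expR /t; lra.
Qed.

Lemma intble_pow_pdf j : intble leb (fun x : R => x ^+ j * pdf x).
Proof.
have [C C0 dom] := normal_pdf_dominates j.
apply: (le_integrable measurableT _ _ (intbleZ C (integrable_normal_pdf 0 2))).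
  apply/measurable_EFinP; apply: measurable_funM; last exact: measurable_normal_pdf.
  exact: measurable_funX.
move=> x _ /=; rewrite lee_fin normrM [`|pdf x|]ger0_norm ?normal_pdf_ge0 //.
by rewrite [leRHS]ger0_norm ?dom // mulr_ge0 ?normal_pdf_ge0 // ltW.
Qed.

Lemma is_derive_pow_pdf j (x : R) :
  is_derive x 1 (fun x => x ^+ j * pdf x) ((j%:R * x ^+ j.-1 - x ^+ j.+1) * pdf x).
Proof.
have XE n (y : R) : ((@id R) ^+ n) y = y ^+ n by rewrite fctE.
have gE (y : R) : - 2^-1 * y ^+ 2 = - (y ^+ 2 / 2) by lra.
have dX n : is_derive x 1 ((@id R) ^+ n) (n%:R * x ^+ n.-1).
  by apply: is_derive_eq; rewrite scaler1.
have dE : is_derive x 1 (expR \o (- 2^-1 \*: ((@id R) ^+ 2))) (- x * expR (- (x ^+ 2 / 2))).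
  apply: is_derive_eq; rewrite /= XE -[_ *: _]/(- 2^-1 * x ^+ 2) gE.
  rewrite -[_ *: _]/(- 2^-1 * (2 * x ^+ 1)) expr1; lra.
have -> : (fun x => x ^+ j * pdf x) =
    (@id R) ^+ j * (normal_peak (1 : R) \*: (expR \o (- 2^-1 \*: ((@id R) ^+ 2)))).
  apply/funext => y; rewrite std_normal_pdfE.
  rewrite -[RHS]/(((@id R) ^+ j) y * (normal_peak 1 * expR (- 2^-1 * ((@id R) ^+ 2) y))).
  by rewrite !XE gE.
apply: is_derive_eq; rewrite std_normal_pdfE XE.
rewrite -[(_ \*: _) x]/(normal_peak 1 * expR (- 2^-1 * ((@id R) ^+ 2) x)) XE gE.
rewrite -![_ *: _]/(_ * _) [x ^+ j.+1]exprSr; ring.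
Qed.

Lemma pow_pdf_bounded j : {C : R | forall x, `|x ^+ j * pdf x| <= C}.
Proof.
have [C C0 dom] := normal_pdf_dominates j.
exists (C * normal_peak 2) => x; rewrite normrM [`|pdf x|]ger0_norm ?normal_pdf_ge0 //.
by apply: le_trans (dom x) _; rewrite ler_pM2l // normal_pdf_ub.
Qed.

Lemma cvg_pow_pdf_pm j (s : R) : `|s| = 1 ->
  ((s * n.+1%:R) ^+ j * pdf (s * n.+1%:R)) @[n --> \oo] --> (0 : R).
Proof.
move=> s1; have [C bC] := pow_pdf_bounded j.+1.
apply/norm_cvg0P; apply: (@squeeze_cvgr _ _ _ _ (fun=> 0) (fun n => C * harmonic n)).
- apply: nearW => n; have n0 : 0 < n.+1%:R :> R by rewrite ltr0n.
  rewrite normr_ge0 /= -(ler_pM2l n0) mulrCA divff ?gt_eqF // mulr1.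
  have := bC (s * n.+1%:R); rewrite exprS -mulrA normrM [`|s * _|]normrM s1 mul1r normr_nat.
  by [].
- exact: cvg_cst.
- rewrite -[X in _ --> X](mulr0 C); apply: cvgM; first exact: cvg_cst.
  exact: cvg_harmonic.
Qed.

(** The derivative of [x ^+ j * pdf x] has integral 0: its integrals over growing symmetric
    intervals are boundary terms that tend to 0, and dominated convergence passes to the line. For
    [j = 0] the coefficient kills the term with the truncated exponent [j.-1]. *)
Lemma rint_pow_pdf j :
  rint leb (fun x : R => x ^+ j.+1 * pdf x) = j%:R * rint leb (fun x => x ^+ j.-1 * pdf x).
Proof.
have i1 := intble_pow_pdf j.+1; have i2 := intble_pow_pdf j.-1.
pose f (x : R) := (j%:R * x ^+ j.-1 - x ^+ j.+1) * pdf x.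
pose F (x : R) := x ^+ j * pdf x.
have fE x : j%:R * (x ^+ j.-1 * pdf x) - x ^+ j.+1 * pdf x = f x by rewrite /f; ring.
have f_ : intble leb f by apply: (@eq_intble _ _ _ leb _ _ fE); apply: intbleB => //; apply: intbleZ.
suff : rint leb f = 0.
  rewrite -(@eq_rint _ _ _ leb _ _ fE) rintB //; last exact: intbleZ.
  by rewrite rintZ // => /eqP; rewrite subr_eq0 => /eqP.
have mf := intble_measurable f_.
pose B n : set R := `[- n.+1%:R, n.+1%:R].
have FTC n : (\int[leb]_(x in B n) (f x)%:E = (F n.+1%:R - F (- n.+1%:R))%:E)%E.
  have dF (x : R) : is_derive x (1 : R) F (f x) := is_derive_pow_pdf j x.
  have cF : continuous F.
    by move=> x; apply: differentiable_continuous; apply/derivable1_diffP; apply: ex_derive.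
  rewrite EFinB; apply: continuous_FTC2.
  - by rewrite gtrN.
  - apply: continuous_subspaceT => x; rewrite /f; apply: cvgM; last exact: continuous_normal_pdf.
    apply: cvgB; last exact: exprn_continuous.
    by apply: cvgM; [exact: cvg_cst|exact: exprn_continuous].
  - split; first by move=> x _; apply: ex_derive.
    + by apply: cvg_at_right_filter; exact: cF.
    + by apply: cvg_at_left_filter; exact: cF.
  - by move=> x _; rewrite derive1E; apply: derive_val.
have cvg1 : (F n.+1%:R - F (- n.+1%:R))%:E @[n --> \oo] --> (0%R : R)%:E.
  apply: cvg_EFin; first exact: nearW.
  rewrite -[X in _ --> X](subr0 0); apply: cvgB.
    have := @cvg_pow_pdf_pm j 1 (normr1 _).
    by under eq_fun do rewrite mul1r.
  have := @cvg_pow_pdf_pm j (-1) (normrN1 _).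
  by under eq_fun do rewrite mulN1r.
have cvg2 : (\int[leb]_(x in B n) (f x)%:E)%E @[n --> \oo] -->
    (\int[leb]_x (f x)%:E)%E.
  pose fn n x := ((f x) * \1_(B n) x)%:E.
  have -> : (fun n => \int[leb]_(x in B n) (f x)%:E)%E =
      (fun n => \int[leb]_x fn n x)%E.
    apply/funext => n; rewrite integral_mkcond; apply: eq_integral => x _.
    rewrite /fn patchE indicE; case: ifP => _; by rewrite ?mulr1 ?mulr0.
  have cvg_fB (x : R) : (f x * \1_(B n) x) @[n --> \oo] --> f x.
    apply: cvg_near_cst; near=> n.
    suff xB : B n x by rewrite indicE mem_set ?mulr1.
    have xn : `|x| < n%:R by near: n; exact: nbhs_infty_gtr.
    rewrite /B /= in_itv /= -ler_norml (le_trans (ltW xn)) // ler_nat.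
    exact: leqnSn.
  apply: (@dominated_cvg _ _ _ leb setT measurableT fn _ (fun x => `|f x|%:E)) => //.
  - move=> n; apply/measurable_EFinP; apply: measurable_funM => //.
    by apply: measurable_indic; exact: measurable_itv.
  - by move=> x _; apply: cvg_EFin; [exact: nearW|exact: cvg_fB].
  - exact: intble_norm.
  - move=> n x _; rewrite lee_fin normrM indicE ler_piMr //.
    by case: (_ \in _); rewrite ?normr1 // normr0.
have := EFin_rint f_; rewrite -(cvg_lim _ cvg2) //.
under eq_fun do rewrite FTC.
rewrite (cvg_lim _ cvg1) // => /eqP; rewrite eqe => /eqP <-.
Unshelve. all: by end_near. Qed.


Local Notation gauss := (normal_prob (0 : R) 1).

Lemma std_normal_moment j :
  intble gauss (fun x => x ^+ j) /\
  rint gauss (fun x => x ^+ j) = rint leb (fun x => x ^+ j * pdf x).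
Proof.
have pdf_ : intble leb pdf by exact: integrable_normal_pdf.
have mpdf := intble_measurable pdf_.
have pdfB B : measurable B -> (\int[leb]_x (pdf x * \1_(id @^-1` B) x)%:E = 1%:E * gauss B)%E.
  move=> mB; rewrite mul1e /normal_prob [RHS]integral_mkcond; apply: eq_integral => x _.
  by rewrite patchE indicE preimage_id; case: ifP => _; rewrite ?mulr1 ?mulr0.
have mX : measurable_fun setT (fun x : R => x ^+ j) by exact: measurable_funX.
have mnX : measurable_fun setT (fun x : R => `|x ^+ j|) by exact: measurableT_comp.
have iX : intble gauss (fun x => x ^+ j).
  have : intble gauss (fun x => `|x ^+ j|).
    apply: intble_ge0 => //.
    have := @ge0_integral_density _ _ _ _ _ leb gauss pdf id 1 mpdf (fun x => normal_pdf_ge0 0 1 x)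
      (@measurable_id _ _ setT) pdfB (fun x => `|x ^+ j|) mnX
      (fun y => normr_ge0 _).
    rewrite mul1e => <-.
    have := intble_norm (intble_pow_pdf j) => /EFin_rint; under eq_integral.
      move=> x _; rewrite normrM [`|pdf x|]ger0_norm ?normal_pdf_ge0 // mulrC; over.
    by move=> ->; rewrite ltry.
  apply: le_integrable => //; first exact/measurable_EFinP.
  by move=> x _ /=; rewrite normr_id.
split=> //.
have pdfR B : measurable B -> rint leb (fun x => pdf x * \1_(id @^-1` B) x) = 1 * fine (gauss B).
  by move=> mB; rewrite /rint /Rintegral pdfB // mul1e mul1r.
have [||_] := @integral_density _ _ _ _ _ leb gauss id _ pdf 1 1 _ pdf_ pdfR _ iX.
- exact: measurable_id.
- move=> B mB; rewrite -pdfR //; apply: eq_rint => x; by rewrite ger0_norm ?normal_pdf_ge0.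
by rewrite mul1r => <-; apply: eq_rint => x; rewrite mulrC.
Qed.

Lemma intble_std_normal j : intble gauss (fun x => x ^+ j).
Proof. by have [] := std_normal_moment j. Qed.

Lemma rint_std_normal j :
  rint gauss (fun x => x ^+ j.+1) = j%:R * rint gauss (fun x => x ^+ j.-1).
Proof.
have [_ ->] := std_normal_moment j.+1; have [_ ->] := std_normal_moment j.-1.
exact: rint_pow_pdf.
Qed.

End GaussianMoments.

(** * Independence *)

Section Factorization.
Local Open Scope classical_set_scope.
Context d d' (Omega : measurableType d) (T : measurableType d') (R : realType).
Context (P : probability Omega R) (nu : probability T R).
Variables (I : finType) (Z : I -> Omega -> T) (A : set Omega).
Hypotheses (mZ : forall i, measurable_fun setT (Z i)) (mA : measurable A).
Hypothesis ZA : forall B : I -> set T, (forall i, measurable (B i)) ->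
  P (A `&` \bigcap_i (Z i @^-1` B i)) = (P A * \prod_i nu (B i))%E.

(** Indices are promoted one at a time from indicators to integrable functions; outside the list
    [s], [phi i] is still an indicator. To promote [i0], [integral_density] is applied to [Z i0]
    with the remaining product as weight; its absolute value is a product of the same kind, since
    indicators are their own absolute values. *)
Lemma rint_prod_indep (phi : I -> T -> R) : (forall i, intble nu (phi i)) ->
  intble P (fun w => \1_A w * \prod_i phi i (Z i w)) /\
  rint P (fun w => \1_A w * \prod_i phi i (Z i w)) = fine (P A) * \prod_i rint nu (phi i).
Proof.
suff H (s : seq I) : forall phi : I -> T -> R, (forall i, intble nu (phi i)) ->
    (forall i, i \notin s -> {B : set T | measurable B & phi i = \1_B}) ->
    intble P (fun w => \1_A w * \prod_i phi i (Z i w)) /\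
    rint P (fun w => \1_A w * \prod_i phi i (Z i w)) = fine (P A) * \prod_i rint nu (phi i).
  by move=> phi_; apply: (H (enum I)) => // i; rewrite mem_enum.
elim: s => [|i0 s IH] {}phi phi_ ind.
  pose B i := s2val (ind i isT).
  have mB i : measurable (B i) by rewrite /B; case: (ind i isT).
  have phiB i : phi i = \1_(B i) by rewrite /B; case: (ind i isT).
  have mZB i : measurable (Z i @^-1` B i).
    by rewrite -[_ @^-1` _]setTI; exact: mZ.
  have mC : measurable (A `&` \bigcap_i (Z i @^-1` B i)).
    by apply: measurableI => //; apply: fin_bigcap_measurable => //; exact: finite_finset.
  have E w : \1_(A `&` \bigcap_i (Z i @^-1` B i)) w = \1_A w * \prod_i phi i (Z i w) :> R.
    rewrite indicI /=; congr (_ * _); rewrite indicE.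
    under eq_bigr do rewrite phiB indicE.
    have [wB|wB] := boolP (_ \in _).
      rewrite big1 // => i _; rewrite mem_set //.
      by move: wB; rewrite inE => /(_ i Logic.I).
    apply/esym/eqP/prodf_eq0; apply: contrapT => nB; move/negP: wB; apply.
    rewrite inE => i _; apply: contrapT => nBi; apply: nB; exists i => //.
    by rewrite memNset.
  split; first by apply: (eq_intble E); exact: integrable_indic.
  rewrite -(eq_rint _ E) /rint /Rintegral integral_indic // setIT.
  transitivity (fine (P A * \prod_i nu (B i))%E); first by congr fine; exact: ZA.
  have -> : (\prod_i nu (B i) = (\prod_i rint nu (phi i))%:E)%E.
    rewrite -prodEFin; apply: eq_bigr => i _.
    by rewrite /rint /Rintegral phiB integral_indic // setIT fineK //; exact: fin_num_measure.
  by rewrite fineM // fin_num_measure.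
pose W w : R := \1_A w * \prod_(i | i != i0) phi i (Z i w).
pose c : R := fine (P A) * \prod_(i | i != i0) rint nu (phi i).
pose c' : R := fine (P A) * \prod_(i | i != i0) rint nu (fun x => `|phi i x|).
pose upd (f : I -> T -> R) g i := if i == i0 then g else f i.
have updE f g w : \1_A w * \prod_i upd f g i (Z i w) =
    (\1_A w * \prod_(i | i != i0) f i (Z i w)) * g (Z i0 w).
  rewrite (bigD1 i0) //= /upd eqxx mulrCA mulrC; congr (_ * _ * _).
  by apply: eq_bigr => i /negPf ->.
have key f g : (forall i, intble nu (f i)) ->
    (forall i, i \notin i0 :: s -> {B : set T | measurable B & f i = \1_B}) ->
    (exists2 B, measurable B & g = \1_B) ->
    intble P (fun w => (\1_A w * \prod_(i | i != i0) f i (Z i w)) * g (Z i0 w)) /\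
    rint P (fun w => (\1_A w * \prod_(i | i != i0) f i (Z i w)) * g (Z i0 w)) =
      fine (P A) * \prod_(i | i != i0) rint nu (f i) * rint nu g.
  move=> f_ find [B mB gB].
  have g_ : intble nu g by rewrite gB; exact: integrable_indic.
  have [i|i si|iU rU] := IH (upd f g).
  - by rewrite /upd; case: ifP.
  - rewrite /upd; case: eqP => [_|/eqP ii0]; first by exists B.
    by apply: find; rewrite inE negb_or ii0.
  split; first exact: (eq_intble (updE f g)).
  rewrite -(eq_rint _ (updE f g)) rU (bigD1 i0) //= {1}/upd eqxx mulrA mulrAC.
  by congr (_ * _ * _); apply: eq_bigr => i /negPf ii0; rewrite /upd ii0.
have rB B : measurable B -> rint nu \1_B = fine (nu B).
  by move=> mB; rewrite /rint /Rintegral integral_indic // setIT.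
have WE w : W w * phi i0 (Z i0 w) = \1_A w * \prod_i phi i (Z i w).
  by rewrite [in RHS](bigD1 i0) //= mulrCA mulrC.
have [|B mB|B mB||iW rW] := @integral_density _ _ _ _ _ P nu (Z i0) (mZ i0) W c c' (phi i0).
- have [||iT _] := key phi \1_setT phi_; last first.
    by apply: eq_intble iT => w; rewrite indicT mulr1.
  + by exists setT.
  + by [].
- have [||_ ->] := key phi \1_B phi_; [by []|by exists B|].
  by rewrite rB.
- have nphi_ i : intble nu (fun x => `|phi i x|) by exact: intble_norm.
  have [||_ E] := key (fun i x => `|phi i x|) \1_B nphi_.
  + move=> i /ind [C mC ->]; exists C => //; apply/funext => x.
    by rewrite indicE normr_nat.
  + by exists B.
  rewrite -rB // -E; apply: eq_rint => w.
  by rewrite /W normrM normr_prod indicE normr_nat.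
- exact: phi_.
split; first exact: (eq_intble WE).
by rewrite -(eq_rint _ WE) rW /c [in RHS](bigD1 i0) //= [RHS]mulrCA [RHS]mulrC.
Qed.

End Factorization.

(** * Expectations of polynomials in the noise, and Stein's identity *)

Section GaussianPolynomial.
Local Open Scope classical_set_scope.
Context d (Omega : measurableType d) (R : realType) (P : probability Omega R).
Variables (N : nat) (Z : 'I_N -> Omega -> measurableTypeR R).
Hypothesis mZ : forall i, measurable_fun setT (Z i).
Local Notation gauss := (normal_prob (0 : R) 1).
Local Notation poly := (mpoly N R).

(** One product formula encodes both the law of the noise and its independence from [A]; for
    [A = setT] it says that the coordinates are independent standard Gaussians. *)
Definition indep_of_noise (A : set Omega) := measurable A /\
  forall B : 'I_N -> set R, (forall i, measurable (B i)) ->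
  P (A `&` \bigcap_i (Z i @^-1` B i)) = (P A * \prod_i gauss (B i))%E.

(** The Gaussian expectation assembled from one-dimensional moments. [gexp] is the same number as an
    integral: positivity is read off the integral, Stein's identity off the moments. *)
Definition gmom (q : poly) : R :=
  \sum_(m <- msupp q) mcoeff m q * \prod_i rint gauss (fun x => x ^+ m i).

Lemma meval_noise A q : indep_of_noise A ->
  intble P (fun w => \1_A w * meval (fun i => Z i w) q) /\
  rint P (fun w => \1_A w * meval (fun i => Z i w) q) = fine (P A) * gmom q.
Proof.
move=> [mA ZA].
have mono m : intble P (fun w => \1_A w * meval (fun i => Z i w) (mpolyX R m)) /\
    rint P (fun w => \1_A w * meval (fun i => Z i w) (mpolyX R m)) =
    fine (P A) * \prod_i rint gauss (fun x => x ^+ m i).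
  have E w : \1_A w * meval (fun i => Z i w) (mpolyX R m) = \1_A w * \prod_i Z i w ^+ m i.
    by rewrite mevalX.
  have [iX rX] := rint_prod_indep mZ mA ZA (fun i => intble_std_normal R (m i)).
  by split; [apply: (eq_intble (fun w => esym (E w)))|rewrite (eq_rint _ E)].
have E w : \1_A w * meval (fun i => Z i w) q =
    \sum_(m <- msupp q) mcoeff m q * (\1_A w * meval (fun i => Z i w) (mpolyX R m)).
  rewrite {1}[q]mpolyE raddf_sum mulr_sumr; apply: eq_bigr => m _ /=.
  by rewrite mevalZ mulrCA.
have key (s : seq (multinom N)) :
  intble P (fun w => \sum_(m <- s) mcoeff m q * (\1_A w * meval (fun i => Z i w) (mpolyX R m))) /\
  rint P (fun w => \sum_(m <- s) mcoeff m q * (\1_A w * meval (fun i => Z i w) (mpolyX R m))) =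
  fine (P A) * \sum_(m <- s) mcoeff m q * \prod_i rint gauss (fun x => x ^+ m i).
  elim: s => [|m s [iS rS]].
    split; first by under eq_fun do rewrite big_nil; exact: integrable0.
    rewrite big_nil mulr0 /rint /Rintegral.
    by under eq_integral do rewrite big_nil; rewrite integral0.
  have [im rm] := mono m.
  have F w : mcoeff m q * (\1_A w * meval (fun i => Z i w) (mpolyX R m)) +
     \sum_(m <- s) mcoeff m q * (\1_A w * meval (fun i => Z i w) (mpolyX R m)) =
     \sum_(m <- m :: s) mcoeff m q * (\1_A w * meval (fun i => Z i w) (mpolyX R m)).
    by rewrite big_cons.
  have im' := intbleZ (mcoeff m q) im.
  split; first by apply: (eq_intble F); exact: intbleD.
  by rewrite -(eq_rint _ F) rintD // rintZ // rm rS big_cons mulrDr mulrCA.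
have [iK rK] := key (msupp q).
by split; [exact: (eq_intble (fun w => esym (E w)))|rewrite (eq_rint _ E)].
Qed.

Hypothesis ZT : indep_of_noise setT.

Definition gexp (q : poly) : R := rint P (fun w => meval (fun i => Z i w) q).

Lemma intble_noise q : intble P (fun w => meval (fun i => Z i w) q).
Proof.
by have [+ _] := meval_noise q ZT; apply: eq_intble => w; rewrite indicT mul1r.
Qed.

Lemma gexpE q : gexp q = gmom q.
Proof.
have [_] := meval_noise q ZT; rewrite probability_setT mul1r => <-.
by apply: eq_rint => w; rewrite indicT mul1r.
Qed.

Lemma gexp_linear a p q : gexp (a *: p + q) = a * gexp p + gexp q.
Proof.
rewrite /gexp -rintZ -?rintD; try exact: intble_noise.
  by apply: eq_rint => w; rewrite mevalD mevalZ.
by apply: intbleZ; exact: intble_noise.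
Qed.

Lemma gexp1 : gexp 1 = 1.
Proof.
rewrite /gexp (@eq_rint _ _ _ _ _ (fun _ => 1)) => [|w]; last by rewrite meval1.
rewrite /rint Rintegral_cst // mul1r -[RHS]/(fine 1%E); congr fine; exact: probability_setT.
Qed.

Lemma gexp_sqr_ge0 p : 0 <= gexp (p * p).
Proof. by apply: rint_ge0 => w; rewrite mevalM -expr2 sqr_ge0. Qed.

Lemma gmomX m : gmom (mpolyX R m) = \prod_i rint gauss (fun x => x ^+ m i).
Proof. by rewrite /gmom msuppX big_seq1 mcoeffX eqxx mul1r. Qed.

Lemma gexp_stein (i : 'I_N) q : gexp (mpolyX R (mnm1 i) * q) = gexp (mderiv i q).
Proof.
have Lsum (s : seq (multinom N)) (F : multinom N -> poly) c :
    gexp (\sum_(m <- s) c m *: F m) = \sum_(m <- s) c m * gexp (F m).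
  elim: s => [|m s IH]; last by rewrite !big_cons gexp_linear IH.
  by rewrite !big_nil gexpE /gmom msupp0 big_nil.
rewrite [q]mpolyE mulr_sumr linear_sum /=.
under eq_bigr do rewrite -scalerAr.
under [in RHS]eq_bigr do rewrite mderivZ.
rewrite !Lsum; apply: eq_bigr => m _; congr (_ * _).
rewrite -mpolyXD mderivX -[X in _ = gexp X]addr0 gexp_linear.
have -> : gexp 0 = 0 by rewrite gexpE /gmom msupp0 big_nil.
rewrite addr0 !gexpE !gmomX.
rewrite (bigD1 i) //= [in RHS](bigD1 i) //= mulrA; congr (_ * _).
  by rewrite mnmDE mnmBE mnm1E eqxx add1n subn1 rint_std_normal.
apply: eq_bigr => j ji; rewrite mnmDE mnmBE mnm1E eq_sym (negPf ji) add0n subn0.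
by [].
Qed.

End GaussianPolynomial.

(** * The biclustering model *)

Section RealSums.
Context d (T : measurableType d) (R : realType) (mu : {measure set T -> \bar R}).
Variables (I : Type) (P : pred I) (f : I -> T -> R).
Hypothesis f_ : forall i, intble mu (f i).

Lemma rint_sum (s : seq I) :
  intble mu (fun x => \sum_(i <- s | P i) f i x) /\
  rint mu (fun x => \sum_(i <- s | P i) f i x) = \sum_(i <- s | P i) rint mu (f i).
Proof.
elim: s => [|i s [iS rS]].
  split; first by under eq_fun do rewrite big_nil; exact: integrable0.
  rewrite big_nil /rint /Rintegral.
  by under eq_integral do rewrite big_nil; rewrite integral0.
have E x : (if P i then f i x else 0) + \sum_(i <- s | P i) f i x = \sum_(i <- i :: s | P i) f i x.
  by rewrite big_cons; case: (P i); rewrite ?add0r.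
rewrite big_cons; case: (P i) E => E.
  split; first by apply: (eq_intble E); exact: intbleD.
  by rewrite -(eq_rint _ E) rintD // rS.
have F x : \sum_(i <- s | P i) f i x = \sum_(i <- i :: s | P i) f i x.
  by rewrite -E add0r.
by split; [exact: (eq_intble F)|rewrite -(eq_rint _ F)].
Qed.

End RealSums.

Section ModelEvents.
Local Open Scope classical_set_scope.
Context (R : realType) (n1 n2 k1 k2 k : nat).
Context (d : measure_display) (Omega : measurableType d) (P : probability Omega R).
Variables (z1 : 'I_n1 -> Omega -> 'I_k1) (z2 : 'I_n2 -> Omega -> 'I_k2).
Hypothesis kE : minn k1 k2 = k.+1.
Hypotheses (uz1 : forall i, uniform_label k1 k2 P (z1 i)).
Hypotheses (uz2 : forall j, uniform_label k1 k2 P (z2 j)).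
Hypothesis indz : mutually_independent P (fun v : 'I_n1 + 'I_n2 =>
  match v with inl i => sigma_label (z1 i) | inr j => sigma_label (z2 j) end).

Local Notation V := ('I_n1 + 'I_n2)%type.
Local Notation labelling := {ffun V -> 'I_k.+1}.
Local Notation pattern := {ffun 'I_n1 * 'I_n2 -> bool}.

Let kk1 : (k.+1 <= k1)%N. Proof. by rewrite -kE geq_minl. Qed.
Let kk2 : (k.+1 <= k2)%N. Proof. by rewrite -kE geq_minr. Qed.

Definition label_set (z : labelling) (v : V) : set Omega :=
  match v with
  | inl i => z1 i @^-1` [set widen_ord kk1 (z v)]
  | inr j => z2 j @^-1` [set widen_ord kk2 (z v)]
  end.

Definition label_event (z : labelling) : set Omega := \bigcap_v label_set z v.

Definition agreement (w : Omega) : pattern := [ffun e => z1 e.1 w == z2 e.2 w :> nat].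

Definition pattern_event (S : pattern) : set Omega := [set w | agreement w = S].

Lemma measurable_label_event z : measurable (label_event z).
Proof.
apply: fin_bigcap_measurable; first exact: finite_finset.
by move=> [i|j] _; [have [+ _] := uz1 i (widen_ord kk1 (z (inl i)))|
  have [+ _] := uz2 j (widen_ord kk2 (z (inr j)))].
Qed.

Lemma measurable_pattern_event S : measurable (pattern_event S).
Proof.
have -> : pattern_event S = \bigcap_(e : 'I_n1 * 'I_n2)
    \bigcup_(ab in [set ab : 'I_k1 * 'I_k2 | (ab.1 == ab.2 :> nat) = S e])
      (z1 e.1 @^-1` [set ab.1] `&` z2 e.2 @^-1` [set ab.2]).
  apply/seteqP; split => w.
    by move=> /ffunP wS e _; exists (z1 e.1 w, z2 e.2 w) => //=; rewrite -wS ffunE.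
  move=> wS; apply/ffunP => e; rewrite ffunE; have [[a b] /= abS [/= -> ->]] := wS e Logic.I.
  exact: abS.
apply: fin_bigcap_measurable => [|e _]; first exact: finite_finset.
apply: fin_bigcup_measurable => [|ab _]; first exact: finite_finset.
by apply: measurableI; [have [+ _] := uz1 e.1 ab.1|have [+ _] := uz2 e.2 ab.2].
Qed.

Lemma prob_label_event z : P (label_event z) = (#|{: labelling}|%:R^-1)%:E.
Proof.
have -> : label_event z = \bigcap_(v in [set` [set: V]%SET]) label_set z v.
  apply/seteqP; split => w zw v _; first exact: zw v Logic.I.
  by apply: zw; rewrite /= finset.in_setT.
rewrite indz => [|v _]; last first.
  by case: v => [i|j] /=; [exists [set widen_ord kk1 (z (inl i))]|
    exists [set widen_ord kk2 (z (inr j))]]; rewrite ?setTI.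
rewrite (eq_bigr (fun _ => (k.+1%:R^-1 : R)%:E)) => [|v _]; last first.
  case: v => [i|j] /=.
    by have [_ ->] := uz1 i (widen_ord kk1 (z (inl i))); rewrite /= kE ltn_ord.
  by have [_ ->] := uz2 j (widen_ord kk2 (z (inr j))); rewrite /= kE ltn_ord.
rewrite prodEFin; congr EFin; rewrite prodr_const cardsT card_ffun card_ord.
by rewrite natrX exprVn.
Qed.

Lemma label_event_agreement z w : label_event z w -> agreement w = pattern_of z.
Proof.
move=> zw; apply/ffunP => e; rewrite !ffunE /agree.
by have /= -> := zw (inl e.1) Logic.I; have /= -> := zw (inr e.2) Logic.I.
Qed.

Lemma label_event_inj z z' w : label_event z w -> label_event z' w -> z = z'.
Proof.
move=> zw zw'; apply/ffunP => -[i|j]; apply: val_inj.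
  have /= /(congr1 val) := zw (inl i) Logic.I; have /= -> := zw' (inl i) Logic.I.
  by move=> /= ->.
have /= /(congr1 val) := zw (inr j) Logic.I; have /= -> := zw' (inr j) Logic.I.
by move=> /= ->.
Qed.

(** The disjoint label events inside a pattern event give only a lower bound, as they cover no
    outcome with a label outside the common range. But both families of weights sum to 1, so every
    inequality is an equality. *)
Lemma prob_pattern_event S : fine (P (pattern_event S)) = pattern_weight R k S.
Proof.
have iA S' : intble P (\1_(pattern_event S') : Omega -> R).
  exact: (integrable_indic P (measurable_pattern_event S')).
have iB z : intble P (\1_(label_event z) : Omega -> R).
  exact: (integrable_indic P (measurable_label_event z)).
have rA S' : rint P (\1_(pattern_event S') : Omega -> R) = fine (P (pattern_event S')).
  by rewrite /rint /Rintegral integral_indic // ?setIT //; exact: measurable_pattern_event.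
have rB z : rint P (\1_(label_event z) : Omega -> R) = #|{: labelling}|%:R^-1.
  rewrite /rint /Rintegral integral_indic // ?setIT; last exact: measurable_label_event.
  by rewrite -[RHS]/(fine _%:E); congr fine; exact: prob_label_event.
have ge S' : pattern_weight R k S' <= fine (P (pattern_event S')).
  have [iS rS] := rint_sum (fun z => pattern_of z == S') iB (index_enum _).
  have -> : pattern_weight R k S' = rint P (fun w =>
      \sum_(z : labelling | pattern_of z == S') \1_(label_event z) w).
    rewrite rS (eq_bigr (fun _ => #|{: labelling}|%:R^-1)) // sumr_const -[RHS]mulr_natl.
    by rewrite /pattern_weight; congr (_%:R * _); apply: eq_card => z; rewrite inE.
  rewrite -rA; apply: (le_Rintegral measurableT iS (iA S')) => w _.
  have [[z zw]|nz] := pselect (exists z, label_event z w); last first.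
    rewrite big1 ?indicE // => z _; rewrite indicE memNset // => zw; apply: nz.
    by exists z.
  rewrite big_mkcond (bigD1 z) //= [X in _ + X]big1 => [|z' z'z]; last first.
    case: ifP => // _; rewrite indicE memNset // => /(label_event_inj zw) zz'.
    by rewrite zz' eqxx in z'z.
  rewrite addr0; case: eqP => [zS|_]; last by rewrite indicE.
  by rewrite !indicE !mem_set // /pattern_event /= (label_event_agreement zw).
have tot : \sum_S' fine (P (pattern_event S')) = 1.
  have [iS rS] := rint_sum xpredT iA (index_enum _).
  rewrite -(eq_bigr _ (fun S' _ => rA S')) -rS.
  rewrite (@eq_rint _ _ _ _ _ (fun _ => 1)) => [|w].
    by rewrite /rint Rintegral_cst // mul1r -[RHS]/(fine 1%E); congr fine; exact: probability_setT.
  rewrite (bigD1 (agreement w)) //= big1 => [|S' S'w]; rewrite indicE.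
    by rewrite mem_set // addr0.
  by rewrite memNset // => wS'; rewrite wS' eqxx in S'w.
apply/eqP; rewrite eq_le ge andbT -subr_le0.
have : \sum_S' (fine (P (pattern_event S')) - pattern_weight R k S') = 0.
  by rewrite sumrB tot sum_pattern_weight1 subrr.
rewrite (bigD1 S) //= => /eqP; rewrite addr_eq0 => /eqP ->.
by rewrite oppr_le0; apply: sumr_ge0 => S' _; rewrite subr_ge0.
Qed.

End ModelEvents.

Section NoiseIndependence.
Local Open Scope classical_set_scope.
Context (R : realType) (n1 n2 k1 k2 : nat).
Context (d : measure_display) (Omega : measurableType d) (P : probability Omega R).
Variables (lambda : R) (z1 : 'I_n1 -> Omega -> 'I_k1) (z2 : 'I_n2 -> Omega -> 'I_k2).
Variables (E : 'I_n1 -> 'I_n2 -> {RV P >-> R}) (M : Omega -> 'M[R]_(n1, n2)).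
Hypothesis lambda0 : lambda != 0.
Hypotheses (uz1 : forall i, uniform_label k1 k2 P (z1 i)).
Hypotheses (uz2 : forall j, uniform_label k1 k2 P (z2 j)).
Hypothesis ME : forall w, M w = latent_signal lambda z1 z2 w.
Hypothesis gaussE : forall i j A, measurable A -> distribution P (E i j) A = normal_prob 0 1 A.
Hypothesis indE : mutually_independent P (fun ij : 'I_n1 * 'I_n2 => sigma_var (E ij.1 ij.2)).
Hypothesis indME : independent_systems P (sigma_mx M) (sigma_mx (noise E)).

Local Notation T := ('I_n1 * 'I_n2)%type.
Variables (idx : T -> 'I_(n1 * n2)) (lab : 'I_(n1 * n2) -> T).
Hypotheses (idxK : cancel idx lab) (labK : cancel lab idx).

Definition noise_coord (v : 'I_(n1 * n2)) : Omega -> measurableTypeR R := E (lab v).1 (lab v).2.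

Lemma measurable_noise_coord v : measurable_fun setT (noise_coord v).
Proof. by move=> mT B mB; exact: (measurable_funPT (E (lab v).1 (lab v).2)). Qed.

Lemma sigma_mx_bigcap (X : Omega -> 'M[R]_(n1, n2)) (B : T -> set R) :
  (forall e, measurable (B e)) ->
  sigma_mx X (\bigcap_e ((fun w => X w e.1 e.2) @^-1` B e)).
Proof.
move=> mB; apply: (@fin_bigcap_measurable _ (g_sigma_algebraType _)) => [|e _].
  exact: finite_finset.
by apply: sub_sigma_algebra; exists e => //=; exists (B e); rewrite ?setTI.
Qed.

Lemma prob_noise_coord (B : 'I_(n1 * n2) -> set R) : (forall v, measurable (B v)) ->
  P (\bigcap_v (noise_coord v @^-1` B v)) = (\prod_v normal_prob 0 1 (B v))%E.
Proof.
move=> mB.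
have -> : \bigcap_v (noise_coord v @^-1` B v) =
    \bigcap_(e in [set` [set: T]%SET]) (E e.1 e.2 @^-1` B (idx e)).
  apply/seteqP; split => w wB.
    by move=> e _ /=; have := wB (idx e) Logic.I; rewrite /noise_coord /= idxK.
  move=> v _; have /= := wB (lab v); rewrite /= finset.in_setT labK => /(_ isT).
  by [].
rewrite indE => [|e _]; last by exists (B (idx e)); rewrite ?setTI.
rewrite (reindex idx) /=; last by exists lab => v _; [exact: idxK|exact: labK].
by apply: eq_big => [e|e _]; [rewrite finset.in_setT|rewrite -(gaussE e.1 e.2 (mB (idx e)))].
Qed.

Lemma indep_of_noise_setT : indep_of_noise P noise_coord setT.
Proof.
by split=> // B mB; rewrite setTI probability_setT mul1e prob_noise_coord.
Qed.

(** As [lambda] is nonzero, the pattern can be read off [M], so its events belong to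
    [sigma_mx M]. *)
Lemma indep_of_noise_pattern S : indep_of_noise P noise_coord (pattern_event z1 z2 S).
Proof.
split=> [|B mB]; first exact: (measurable_pattern_event uz1 uz2).
rewrite -prob_noise_coord //.
have -> : pattern_event z1 z2 S =
    \bigcap_e ((fun w => M w e.1 e.2) @^-1` [set lambda * (S e)%:R]).
  apply/seteqP; split => w.
    by move=> wS e _; rewrite /= ME !mxE -wS ffunE.
  move=> wS; apply/ffunP => e; have := wS e Logic.I; rewrite /= ME !mxE ffunE.
  by move=> /(mulfI lambda0)/eqP; rewrite eqr_nat; case: (z1 _ w == z2 _ w :> nat); case: (S e).
have -> : \bigcap_v (noise_coord v @^-1` B v) =
    \bigcap_(e : T) ((fun w => noise E w e.1 e.2) @^-1` B (idx e)).
  apply/seteqP; split => w wB.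
    by move=> e _ /=; have := wB (idx e) Logic.I; rewrite /noise_coord /= idxK mxE.
  move=> v _; have /= := wB (lab v) Logic.I; rewrite labK mxE.
  by [].
apply: indME; apply: sigma_mx_bigcap => // e.
Qed.

End NoiseIndependence.

(** * The bound for one entry, and the average over entries *)

Section LowDegreeEntry.
Local Open Scope classical_set_scope.
Context (R : realType) (n1 n2 k1 k2 k : nat).
Context (d : measure_display) (Omega : measurableType d) (P : probability Omega R).
Variables (lambda : R) (z1 : 'I_n1 -> Omega -> 'I_k1) (z2 : 'I_n2 -> Omega -> 'I_k2).
Variables (E : 'I_n1 -> 'I_n2 -> {RV P >-> R}) (M Y : Omega -> 'M[R]_(n1, n2)).
Hypotheses (lambda0 : lambda != 0) (kE : minn k1 k2 = k.+1).
Hypotheses (uz1 : forall i, uniform_label k1 k2 P (z1 i)).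
Hypotheses (uz2 : forall j, uniform_label k1 k2 P (z2 j)).
Hypothesis indz : mutually_independent P (fun v : 'I_n1 + 'I_n2 =>
  match v with inl i => sigma_label (z1 i) | inr j => sigma_label (z2 j) end).
Hypothesis ME : forall w, M w = latent_signal lambda z1 z2 w.
Hypothesis gaussE : forall i j A, measurable A -> distribution P (E i j) A = normal_prob 0 1 A.
Hypothesis indE : mutually_independent P (fun ij : 'I_n1 * 'I_n2 => sigma_var (E ij.1 ij.2)).
Hypothesis indME : independent_systems P (sigma_mx M) (sigma_mx (noise E)).
Hypothesis YE : forall w, Y w = M w + noise E w.

Local Notation T := ('I_n1 * 'I_n2)%type.
Local Notation pattern := {ffun T -> bool}.
Variables (idx : T -> 'I_(n1 * n2)) (lab : 'I_(n1 * n2) -> T).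
Hypotheses (idxK : cancel idx lab) (labK : cancel lab idx).
Hypothesis idxE : forall e, idx e = mxvec_index e.1 e.2.
Variables (r : R) (D : nat).
Hypotheses (n1_gt0 : (0 < n1)%N) (r0 : 0 <= r) (r1 : r < 1).
Hypothesis hsnr : lambda ^+ 2 <=
  r / ((D * (D + 1)) ^ 2)%:R * Num.min 1 ((k.+1 ^ 2)%:R / (maxn n1 n2)%:R).

Local Notation Z := (noise_coord E lab).
Local Notation hermp := (herm (pvar R idx) (pderiv R idx)).

Lemma entry_error_pattern (x : T) (F : pattern -> mpoly (n1 * n2) R) (f : mpoly (n1 * n2) R) :
  (forall S z, meval (fun v => pattern_signal lambda S (lab v) + z v) f = meval z (F S)) ->
  forall w, (meval (fun v => mxvec (Y w) 0 v) f - M w x.1 x.2) ^+ 2 =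
    \sum_S \1_(pattern_event z1 z2 S) w * meval (fun v => Z v w)
      ((F S - pattern_signal lambda S x *: 1) * (F S - pattern_signal lambda S x *: 1)).
Proof.
move=> fF w; rewrite (bigD1 (agreement z1 z2 w)) //= big1 => [|S Sw]; last first.
  by rewrite indicE memNset ?mul0r // => wS; rewrite wS eqxx in Sw.
rewrite indicE mem_set // mul1r addr0 mevalM -expr2; congr (_ ^+ 2).
have MS e : M w e.1 e.2 = pattern_signal lambda (agreement z1 z2 w) e.
  by rewrite ME !mxE /pattern_signal ffunE.
rewrite mevalB mevalZ meval1 mulr1 -fF MS; congr (_ - _).
by apply: meval_eq => v; rewrite -{1}[v]labK idxE mxvecE YE mxE MS mxE.
Qed.

Lemma low_degree_entry_bound (x : T) (f : mpoly (n1 * n2) R) : (mpoly.msize f <= D.+1)%N ->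
  intble P (fun w => (meval (fun v => mxvec (Y w) 0 v) f - M w x.1 x.2) ^+ 2) /\
  lambda ^+ 2 / k.+1%:R - (lambda ^+ 2 / (k.+1 ^ 2)%:R +
     r * (2 - r) * lambda ^+ 2 / ((1 - r) ^+ 2 * (maxn n1 n2)%:R)) <=
  rint P (fun w => (meval (fun v => mxvec (Y w) 0 v) f - M w x.1 x.2) ^+ 2).
Proof.
move=> fD; have [c cD cE] := in_span_mpoly idxK labK fD.
pose F S := \sum_(cu <- c) cu.1 *: hermp (pattern_signal lambda S) cu.2.
pose G (S : pattern) := (F S - pattern_signal lambda S x *: 1) * (F S - pattern_signal lambda S x *: 1).
have mZ := @measurable_noise_coord _ _ _ _ _ P E lab.
have ZT : indep_of_noise P Z setT by exact: (@indep_of_noise_setT _ _ _ _ _ P E gaussE indE idx lab).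
have ZA S := @meval_noise _ _ _ P _ Z mZ _ (G S)
  (indep_of_noise_pattern lambda0 uz1 uz2 ME gaussE indE indME idxK labK S).
have [iS rS] := rint_sum xpredT (fun S => (ZA S).1) (index_enum _).
have EE := @entry_error_pattern x F f (fun S z => cE _ z).
split; first exact: (eq_intble (fun w => esym (EE w))).
rewrite (eq_rint _ EE) rS.
rewrite (eq_bigr (fun S => pattern_weight R k S * gexp P Z (G S))) => [|S _]; last first.
  have [_ ->] := ZA S; rewrite (gexpE mZ ZT); congr (_ * _).
  exact: (prob_pattern_event kE uz1 uz2 indz).
have := @low_degree_duality R T (mpoly (n1 * n2) R) (pvar R idx) (pderiv R idx)
  (@pderivM _ _ _ _) (pderivX R idxK) (@pderivC _ _ _ _) (gexp P Z)
  (gexp_linear mZ ZT) (gexp1 P Z)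
  (fun e => gexp_stein mZ ZT (idx e)) (@gexp_sqr_ge0 _ _ _ P _ Z)
  pattern (@pattern_weight R _ _ k) (pattern_signal lambda) x D c
  (pattern_weight_ge0 R k) (sum_pattern_weight1 R _ _ k) cD.
cbv zeta; apply: le_trans; rewrite pattern_signal_sqr.
rewrite lerD2l lerN2.
pose kL s := cumulant (fun s => lambda ^+ size s * agree_prob R k s)
  (fun s => lambda ^+ (size s).+1 * agree_prob R k (x :: s)) s.
have kE' s : cumulant (fun s => \sum_i pattern_weight R k i * mono (pattern_signal lambda i) s)
    (fun s => \sum_i pattern_weight R k i * mono (pattern_signal lambda i) (x :: s)) s = kL s.
  by congr (cumulant _ _ s); apply/funext => t; rewrite pattern_moment.
under eq_bigr => j _ do under eq_ssum => s _ do rewrite kE'.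
(* The term [j = 0] is the squared mean of [x], that is [(lambda / k.+1) ^+ 2]; the others form the
   energy, with [q] the inverse of the larger dimension. *)
rewrite big_ord_recl fact0 invr1 mul1r.
apply: lerD.
  rewrite /= /kL /cumulant /= agree_prob_edge expr1 exprMn exprVn natrX.
  by [].
have n_gt0 : 0 < (maxn n1 n2)%:R :> R by rewrite ltr0n leq_max n1_gt0.
have q_gt0 : 0 < (maxn n1 n2)%:R^-1 :> R by rewrite invr_gt0.
have card_q m : (m <= maxn n1 n2)%N -> #|'I_m|%:R * (maxn n1 n2)%:R^-1 <= 1 :> R.
  by move=> mn; rewrite card_ord ler_pdivrMr // mul1r ler_nat.
have := @energy_bound R _ _ k x _ q_gt0 (card_q _ (leq_maxl _ _)) (card_q _ (leq_maxr _ _))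
  lambda r D r0 r1 hsnr.
rewrite big_add1 big_mkord => energy.
have -> : r * (2 - r) * lambda ^+ 2 / ((1 - r) ^+ 2 * (maxn n1 n2)%:R) =
    r * (2 - r) / (1 - r) ^+ 2 * lambda ^+ 2 / (maxn n1 n2)%:R.
  by field; rewrite ?gt_eqF ?subr_gt0.
by under eq_bigr do rewrite lift0.
Qed.

End LowDegreeEntry.

Lemma rint_loss_ge (R : realType) (n1 n2 : nat) (d : measure_display)
    (Omega : measurableType d) (P : probability Omega R) (A B : Omega -> 'M[R]_(n1, n2)) (b : R) :
  (0 < n1)%N -> (0 < n2)%N ->
  (forall i j, intble P (fun w => (A w i j - B w i j) ^+ 2) /\
     b <= rint P (fun w => (A w i j - B w i j) ^+ 2)) ->
  (b%:E <= 'E_P [fun w => loss (A w) (B w)])%E.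
Proof.
move=> n1_gt0 n2_gt0 Ab.
have row_ i := rint_sum xpredT (fun j => (Ab i j).1) (index_enum _).
have [all_ rall] := rint_sum xpredT (fun i => (row_ i).1) (index_enum _).
rewrite unlock -[X in (_ <= X)%E]/(\int[P]_w (loss (A w) (B w))%:E)%E EFin_rint; last exact: intbleZ.
rewrite lee_fin rintZ // rall ler_pdivlMl ?ltr0n ?muln_gt0 ?n1_gt0 //.
rewrite (eq_bigr _ (fun i _ => (row_ i).2)).
apply: (@le_trans _ _ (\sum_(i < n1) \sum_(j < n2) b)).
  by rewrite !sumr_const !card_ord -mulrnA mulr_natl mulnC.
by apply: ler_sum => i _; apply: ler_sum => j _; have [] := Ab i j.
Qed.

Theorem theorem7 (R : realType) (n1 n2 k1 k2 : nat)
    (hn1 : (0 < n1)%N) (hn2 : (0 < n2)%N) (hk1 : (0 < k1)%N) (hk2 : (0 < k2)%N)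
    (lambda : R) (hlambda : 0 < lambda)
    (d : measure_display) (Omega : measurableType d) (P : probability Omega R)
    (M Y : Omega -> 'M[R]_(n1, n2)) (hMY : bc_model k1 k2 P lambda M Y)
    (r : R) (hr0 : 0 < r) (hr1 : r < 1) (D : nat) (hD : (1 <= D)%N)
    (hsnr : lambda ^+ 2 <=
       r / ((D * (D + 1)) ^ 2)%:R *
       Num.min 1 ((minn (k1 ^ 2) (k2 ^ 2))%:R / (maxn n1 n2)%:R)) :
  ((lambda ^+ 2 / (minn k1 k2)%:R -
     (lambda ^+ 2 / (minn (k1 ^ 2) (k2 ^ 2))%:R +
      r * (2 - r) * lambda ^+ 2 / ((1 - r) ^+ 2 * (maxn n1 n2)%:R)))%:E
   <= low_degree_mmse P D M Y)%E.
Proof.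
have [[z1 [z2 [uz1 uz2 indz ME]]] [E [gaussE indE indME YE]]] := hMY.
(* [k] is one less than the number of labels in use, so that ['I_k.+1] carries a group structure. *)
have [k kE] : exists k, minn k1 k2 = k.+1.
  by exists (minn k1 k2).-1; rewrite prednK // leq_min hk1.
have kE2 : minn (k1 ^ 2) (k2 ^ 2) = (k.+1 ^ 2)%N.
  rewrite -kE; case: (leqP k1 k2) => [k12|/ltnW k21].
    by apply/minn_idPl; rewrite leq_exp2r.
  by apply/minn_idPr; rewrite leq_exp2r.
rewrite kE2 in hsnr *; rewrite kE.
pose idx (e : 'I_n1 * 'I_n2) := mxvec_index e.1 e.2.
have [lab idxK labK] : bijective idx.
  have [lab idxK labK] := @curry_mxvec_bij n1 n2; exists lab => [[i j]|v].
    exact: (idxK (i, j)).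
  by have := labK v isT; case: (lab v).
apply: le_ereal_inf_tmp => _ [Mhat MhatD <-].
apply: rint_loss_ge => // i j.
have := low_degree_entry_bound (lt0r_neq0 hlambda) kE uz1 uz2 indz ME gaussE indE indME YE
  idxK labK (fun _ => erefl) hn1 (ltW hr0) hr1 hsnr (i, j) (MhatD i j).
rewrite /=.
have E' w : (meval (fun v => mxvec (Y w) 0 v) (Mhat i j) - M w i j) ^+ 2 =
  (estimate Mhat (Y w) i j - M w i j) ^+ 2 by rewrite mxE.
rewrite (eq_rint _ E') => -[iE bE]; split=> //; exact: (eq_intble E').
Qed.
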